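(* Let $n\ge 1$ and $k\ge 1$ be integers, let $c>0$ be real, and let $p:\mathbb{R}\to\mathbb{R}$ be a polynomial of degree $d$ such that (1) $0 \le p(i) \le 1$ for every $i = 0,1,\dots,n$, and (2) $\sup_{x\in[0,n]} |p^{(k)}(x)| \geq c$. Then either $d^2 \geq \sqrt{6}\, n$, or the ratio $x = d^2/n$ satisfies \[ \left(1 - \frac{x^2}{6}\right)\frac{(2k-1)!!}{2^{k-1}}\, c < x^k, \] where $(2k-1)!! = (2k-1)(2k-3)\cdots 3\cdot 1$.
   Context: $p^{(k)}$ denotes the $k$-th derivative of $p$. *)

(* Defs.v *)
From HB Require Import structures.
From mathcomp Require Import all_boot all_order all_algebra.
From mathcomp Require Import all_classical all_reals.
Set Implicit Arguments. Unset Strict Implicit. Unset Printing Implicit Defensive.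

Fixpoint dfact (n : nat) : nat :=
  match n with
  | 0 => 1
  | 1 => 1
  | (m.+2) as n' => n' * dfact m
  end.

(* Main.v *)
Require Import Defs.
From HB Require Import structures.
From mathcomp Require Import all_boot all_order all_algebra.
From mathcomp Require Import all_classical all_reals.
From mathcomp Require Import complex polyrcf trigo.
From mathcomp Require Import ring lra zify.
Import Order.TTheory GRing.Theory Num.Theory.
Local Open Scope classical_set_scope.
Local Open Scope ring_scope.

(** Put q = p - 1/2 and let M bound |q| on [0, n]. V. A. Markov's inequality
    |q^(k)| <= M (2/n)^k T_d^(k)(1), with T_d the Chebyshev polynomial, bounds q''; as
    |q| <= 1/2 at the integers, linear interpolation between consecutive integers gives
    M <= 1/2 + M d^2 (d^2 - 1) / (6 n^2), and Markov's inequality for k concludes since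
    (2k-1)!! T_d^(k)(1) = d^2 (d^2 - 1) ... (d^2 - (k-1)^2).

    Markov's inequality is proved following Duffin and Schaeffer. If |p| <= 1 on [-1, 1],
    Lagrange interpolation at the extrema of T bounds |p'| by |T'| at the roots of T,
    whence |p'(x + iy)| <= |T'(1 + iy)| for -1 <= x <= 1. A polynomial B without roots
    in Re z >= 0 that dominates A on the imaginary axis keeps doing so after
    differentiation: B - mu A has no root in Re z >= 0 for |mu| < 1, hence neither has
    its derivative, by Gauss-Lucas. Iterating yields |p^(k)(x)| <= T^(k)(1). *)

Set Implicit Arguments. Unset Strict Implicit. Unset Printing Implicit Defensive.

(** * Complex numbers and Hurwitz polynomials *)

Notation Rec := complex.Re.
Notation Imc := complex.Im.
Notation normc := Normc.normc.

Section ComplexNorm.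
Variable R : rcfType.
Implicit Types (z w : R[i]) (x y : R).

Lemma normc_ge0 z : 0 <= normc z.
Proof. by case: z => a b; apply: sqrtr_ge0. Qed.

Lemma normc_sqr z : normc z ^+ 2 = Rec z ^+ 2 + Imc z ^+ 2.
Proof. by case: z => a b /=; rewrite sqr_sqrtr // addr_ge0 // sqr_ge0. Qed.

Lemma normc_gt0 z : (0 < normc z) = (z != 0).
Proof.
rewrite lt_def normc_ge0 andbT; congr negb; apply/eqP/eqP => [/Normc.eq0_normc //|->].
exact: Normc.normc0.
Qed.

Lemma normc_toC x : normc x%:C%C = `|x|.
Proof. by rewrite /= expr0n addr0 sqrtr_sqr. Qed.

Lemma Rec_le_normc z : Rec z <= normc z.
Proof.
apply: le_trans (ler_norm _) _.
rewrite -(@ler_pXn2r _ 2) ?nnegrE ?normc_ge0 // normc_sqr real_normK ?num_real //.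
by rewrite lerDl sqr_ge0.
Qed.

Lemma normc_le z w :
  Rec z ^+ 2 + Imc z ^+ 2 <= Rec w ^+ 2 + Imc w ^+ 2 -> normc z <= normc w.
Proof.
by rewrite -!normc_sqr ler_pXn2r ?nnegrE ?normc_ge0.
Qed.

Lemma normc_prod (I : Type) (r : seq I) (F : I -> R[i]) :
  normc (\prod_(i <- r) F i) = \prod_(i <- r) normc (F i).
Proof.
elim/big_rec2: _ => [|i u v _ <-]; [exact: Normc.normc1 | exact: Normc.normcM].
Qed.

Lemma normcX z n : normc (z ^+ n) = normc z ^+ n.
Proof.
elim: n => [|n IH]; first exact: Normc.normc1.
by rewrite !exprS Normc.normcM IH.
Qed.

Lemma ler_normc_sum (I : Type) (r : seq I) (F : I -> R[i]) :
  normc (\sum_(i <- r) F i) <= \sum_(i <- r) normc (F i).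
Proof.
elim/big_rec2: _ => [|i u v _ le_uv]; first by rewrite Normc.normc0.
by apply: le_trans (le_normcD _ _) _; rewrite lerD2l.
Qed.

Lemma RecD z w : Rec (z + w) = Rec z + Rec w.
Proof. by case: z w => [? ?] [? ?]. Qed.

Lemma ImcD z w : Imc (z + w) = Imc z + Imc w.
Proof. by case: z w => [? ?] [? ?]. Qed.

Lemma Rec_sum (I : Type) (r : seq I) (F : I -> R[i]) :
  Rec (\sum_(i <- r) F i) = \sum_(i <- r) Rec (F i).
Proof. by elim/big_rec2: _ => [//|i u v _ <-]; rewrite RecD. Qed.

Lemma Imc_sum (I : Type) (r : seq I) (F : I -> R[i]) :
  Imc (\sum_(i <- r) F i) = \sum_(i <- r) Imc (F i).
Proof. by elim/big_rec2: _ => [//|i u v _ <-]; rewrite ImcD. Qed.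

Lemma Rec_inv_gt0 z : 0 < Rec z -> 0 < Rec z^-1.
Proof.
case: z => a b /= a_gt0; rewrite divr_gt0 //.
by rewrite ltr_pwDl ?sqr_ge0 // exprn_gt0.
Qed.

End ComplexNorm.

Lemma horner_deriv_prod_XsubC (F : fieldType) (rs : seq F) (z : F) :
  z \notin rs ->
  (\prod_(r <- rs) ('X - r%:P))^`().[z]
  = (\prod_(r <- rs) ('X - r%:P)).[z] * \sum_(r <- rs) (z - r)^-1.
Proof.
elim: rs => [|r rs IH]; first by rewrite !big_nil derivE hornerC mulr0.
rewrite inE negb_or => /andP[zr zrs].
rewrite !big_cons derivM derivXsubC mul1r hornerD !hornerM hornerXsubC IH //.
by field; rewrite subr_eq0.
Qed.

Section HalfPlane.
Variable R : realType.
Implicit Types (A B : {poly R[i]}) (z : R[i]).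

(** The inequality is strict, so the imaginary axis carries no root. The zero polynomial is
    excluded, every point being a root of it, while nonzero constants are allowed. *)
Definition hurwitz B := forall z, root B z -> Rec z < 0.

Lemma hurwitz_neq0 B : hurwitz B -> B != 0.
Proof.
by move=> hB; apply/eqP => B0; have := hB 0; rewrite B0 root0 /= ltxx => /(_ isT).
Qed.

Lemma hurwitz_factor B : hurwitz B ->
  exists2 rs : seq R[i], (forall r, r \in rs -> Rec r < 0) &
    size rs = (size B).-1 /\
    forall z, B.[z] = lead_coef B * \prod_(r <- rs) (z - r).
Proof.
move=> hB; have [rs Brs] := closed_field_poly_normal B.
have lB0 : lead_coef B != 0 by rewrite lead_coef_eq0 hurwitz_neq0.
exists rs => [r r_rs|].
  by apply: hB; rewrite Brs rootZ // root_prod_XsubC.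
split=> [|z]; first by rewrite [in RHS]Brs size_scale // size_prod_XsubC.
rewrite {1}Brs hornerZ horner_prod; congr (_ * _).
by apply: eq_bigr => r _; rewrite hornerXsubC.
Qed.

(* Gauss-Lucas: B'/B = sum 1/(z - r) has positive real part where Re z >= 0. *)
Lemma hurwitz_deriv B : (1 < size B)%N -> hurwitz B -> hurwitz B^`().
Proof.
move=> sB hB z; rewrite ltNge => rz; apply/negP => z_ge0; move: rz; apply/negP.
have lB0 : lead_coef B != 0 by rewrite lead_coef_eq0 hurwitz_neq0.
have [rs Brs] := closed_field_poly_normal B.
have rs_lt r : r \in rs -> Rec r < 0.
  by move=> rrs; apply: hB; rewrite Brs rootZ // root_prod_XsubC.
have srs : (0 < size rs)%N.
  by move: sB; rewrite Brs size_scale // size_prod_XsubC.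
have zrs : z \notin rs by apply/negP => /rs_lt; rewrite ltNge z_ge0.
rewrite rootE Brs derivZ hornerZ horner_deriv_prod_XsubC //.
rewrite !mulf_neq0 //; first by rewrite -rootE root_prod_XsubC.
apply/eqP => /(congr1 (@Rec R)); rewrite Rec_sum => s0.
suff: 0 < \sum_(r <- rs) Rec (z - r)^-1 by rewrite s0 ltxx.
case: rs rs_lt srs {Brs zrs s0} => // r rs rs_lt _.
have pos w : w \in r :: rs -> 0 < Rec (z - w)^-1.
  move=> /rs_lt w_lt; apply: Rec_inv_gt0; case: z w z_ge0 w_lt => [a b] [c d] /=.
  by move=> *; lra.
rewrite big_cons ltr_pwDl ?pos ?mem_head //.
by rewrite big_seq sumr_ge0 // => w wrs; rewrite ltW // pos // inE wrs orbT.
Qed.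

(** Each root [r] satisfies |z - r| >= Re (z - r) >= Re z. The bound depends on [B] only through its
    size and leading coefficient, so it is uniform along a family of Hurwitz polynomials sharing
    these. *)
Lemma hurwitz_ge_Rec B z : hurwitz B -> 0 <= Rec z ->
  normc (lead_coef B) * Rec z ^+ (size B).-1 <= normc B.[z].
Proof.
move=> hB z_ge0; have [rs rs_lt [<- ->]] := hurwitz_factor hB.
rewrite Normc.normcM ler_wpM2l ?normc_ge0 // normc_prod.
have -> : Rec z ^+ size rs = \prod_(r <- rs) Rec z.
  by rewrite big_const_seq count_predT iter_mulr_1.
rewrite big_seq [leRHS]big_seq; apply: ler_prod => r /rs_lt r_lt; rewrite z_ge0 /=.
apply: le_trans (Rec_le_normc _); case: z r z_ge0 r_lt => [a b] [c d] /=.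
by move=> *; lra.
Qed.

(** As Re r < 0 <= Re z, each factor |z - r| is at least a fixed multiple of 1 + |z|. This prevents
    roots from arriving from infinity under a small perturbation. *)
Lemma hurwitz_growth B : hurwitz B -> exists2 k : R, 0 < k &
  forall z, 0 <= Rec z -> k * (1 + normc z) ^+ (size B).-1 <= normc B.[z].
Proof.
move=> hB; have [rs rs_lt [<- Brs]] := hurwitz_factor hB.
suff [k k_gt0 kP] : exists2 k : R, 0 < k & forall z, 0 <= Rec z ->
    k * (1 + normc z) ^+ size rs <= \prod_(r <- rs) normc (z - r).
  have lB0 : 0 < normc (lead_coef B).
    by rewrite normc_gt0 lead_coef_eq0 hurwitz_neq0.
  exists (normc (lead_coef B) * k); first exact: mulr_gt0.
  by move=> z /kP zk; rewrite Brs Normc.normcM normc_prod -mulrA ler_wpM2l // ltW.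
elim: rs rs_lt {Brs} => [|r rs IH] rs_lt.
  by exists 1 => // z _; rewrite big_nil expr0 mulr1.
have [|k k_gt0 kP] := IH; first by move=> w wrs; apply: rs_lt; rewrite inE wrs orbT.
have r_lt : Rec r < 0 by apply: rs_lt; rewrite mem_head.
(* Since |z - r| >= - Re r, the number 1 + |r| is at most |z - r| (1 + |r|) / (- Re r); with |z| <=
   |z - r| + |r| this gives 1 + |z| <= m |z - r|. *)
pose m : R := 1 + (1 + normc r) / - Rec r.
have m_gt0 : 0 < m.
  by rewrite /m addr_gt0 // divr_gt0 ?oppr_gt0 // ltr_pwDl // normc_ge0.
exists (m^-1 * k) => [|z z_ge0]; first by rewrite mulr_gt0 ?invr_gt0.
rewrite big_cons /= exprS mulrACA ler_pM ?kP //.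
- by rewrite mulr_ge0 ?invr_ge0 ?(ltW m_gt0) // addr_ge0 ?normc_ge0.
- by rewrite mulr_ge0 ?(ltW k_gt0) // exprn_ge0 // addr_ge0 ?normc_ge0.
rewrite mulrC ler_pdivrMr //.
have h1 : normc z <= normc (z - r) + normc r.
  by have := le_normcD (z - r) r; rewrite subrK.
have h2 : - Rec r <= normc (z - r).
  apply: le_trans (Rec_le_normc _); case: z r z_ge0 {r_lt m m_gt0 h1 rs_lt} => [a b] [c d] /=.
  by move=> *; lra.
rewrite /m mulrDr mulr1 mulrCA.
have : 1 + normc r <= (1 + normc r) * (normc (z - r) * (- Rec r)^-1).
  by rewrite ler_peMr ?addr_ge0 ?normc_ge0 // ler_pdivlMr ?oppr_gt0 // mul1r.
by move=> h3; lra.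
Qed.

Lemma poly_growth A m : (size A <= m.+1)%N -> exists2 K : R, 0 <= K &
  forall z, normc A.[z] <= K * (1 + normc z) ^+ m.
Proof.
move=> sA; exists (\sum_(i < m.+1) normc A`_i).
  by rewrite sumr_ge0 // => i _; apply: normc_ge0.
move=> z; rewrite (horner_coef_wide _ sA) mulr_suml.
apply: le_trans (ler_normc_sum _ _) _; apply: ler_sum => i _.
rewrite Normc.normcM normcX ler_wpM2l ?normc_ge0 //.
have z1 : normc z <= 1 + normc z by rewrite lerDr.
apply: le_trans (_ : (1 + normc z) ^+ i <= _).
  by apply: lerXn2r => //; rewrite nnegrE ?addr_ge0 ?normc_ge0.
by apply: ler_weXn2l; [rewrite lerDl normc_ge0 | rewrite -ltnS].
Qed.

(** Connectedness of [0, 1]: the supremum of the [t] such that [P] holds on [0, t] satisfies [P] by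
    closedness, and openness forbids that it be less than 1. *)
Lemma interval_induction (P : R -> Prop) : P 0 ->
  (forall t, 0 < t <= 1 -> (forall s, 0 <= s < t -> P s) -> P t) ->
  (forall t, 0 <= t <= 1 -> P t ->
     exists2 e, 0 < e & forall s, t <= s <= 1 -> s - t < e -> P s) ->
  P 1.
Proof.
move=> P0 Pclosed Popen.
pose E := [set t : R | 0 <= t <= 1 /\ forall s, 0 <= s <= t -> P s].
have E0 : E 0.
  by split=> [|s]; [rewrite lexx ler01 | rewrite -eq_le => /eqP <-].
have Eub : ubound E 1 by move=> t [/andP[]].
have Esup : has_sup E by split; [exists 0 | exists 1].
have s0 : 0 <= sup E by apply: ub_le_sup E0; exists 1.
have s1 : sup E <= 1 by apply: ge_sup => //; exists 0.
have Plt s : 0 <= s < sup E -> P s.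
  move=> /andP[s_ge0 s_lt]; have := @sup_adherent _ E (sup E - s).
  rewrite subr_gt0 => /(_ s_lt Esup)[t [t01 tP]].
  rewrite opprB addrC subrK => st; apply: tP; rewrite s_ge0.
  exact: ltW.
have Ps : P (sup E).
  move: s0; rewrite le_eqVlt => /predU1P[<- //|s_gt0].
  by apply: Pclosed Plt; rewrite s_gt0.
have [->//|sne1] := eqVneq 1 (sup E).
have [|e e_gt0 eP] := Popen (sup E) _ Ps; first by rewrite s0.
have s_lt1 : sup E < 1 by rewrite lt_neqAle eq_sym sne1.
pose t := Num.min 1 (sup E + e / 2).
have st : sup E < t by rewrite lt_min s_lt1 ltrDl divr_gt0.
suff Et : E t.
  have : t <= sup E by apply: ub_le_sup Et; exists 1.
  by rewrite leNgt st.
split=> [|s /andP[s_ge0 s_le]].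
  by rewrite (le_trans s0 (ltW st)) ge_min lexx.
have [s_lt|s_ge] := ltP s (sup E); first by apply: Plt; rewrite s_ge0.
move: s_le; rewrite le_min => /andP[s_le1 s_le2].
by apply: eP; [rewrite s_ge | lra].
Qed.

End HalfPlane.

(** * Domination on the imaginary axis *)

Lemma size_deriv_num (F : numDomainType) (p : {poly F}) :
  size p^`() = (size p).-1.
Proof.
case sp: (size p) => [|[|n]] /=.
- by move/eqP: sp; rewrite size_poly_eq0 => /eqP ->; rewrite deriv0 size_poly0.
- by rewrite [p]size1_polyC ?sp // derivC size_poly0.
rewrite /deriv sp size_poly_eq //= mulrn_eq0 /=.
have : lead_coef p != 0 by rewrite lead_coef_eq0 -size_poly_eq0 sp.
by rewrite lead_coefE sp.
Qed.

Section Domination.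
Variable R : realType.
Implicit Types (A B : {poly R[i]}) (z w : R[i]).

(** The conditions on the size and on the coefficient of [A] at the degree of [B] express domination
    at infinity: they let B - w A keep the degree of B when |w| < 1. *)
Definition dominated A B := [/\ hurwitz B, (size A <= size B)%N,
  normc A`_(size B).-1 <= normc (lead_coef B) &
  forall y : R, normc A.[(0 +i* y)%C] <= normc B.[(0 +i* y)%C]].

Lemma dominated_lead A B w : dominated A B -> normc w < 1 ->
  size (B - w *: A) = size B /\
  (1 - normc w) * normc (lead_coef B) <= normc (lead_coef (B - w *: A)).
Proof.
move=> [hB sAB lAB _] w1; have B0 := hurwitz_neq0 hB.
have lB : 0 < normc (lead_coef B) by rewrite normc_gt0 lead_coef_eq0.
have sBw : (size (B - w *: A)%R <= size B)%N.
  apply: leq_trans (size_polyD _ _) _; rewrite size_polyN geq_max leqnn /=.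
  exact: leq_trans (size_scale_leq _ _) sAB.
have key : (1 - normc w) * normc (lead_coef B) <= normc (B - w *: A)`_(size B).-1.
  rewrite coefB coefZ -/(lead_coef B).
  have := le_normcD (lead_coef B - w * A`_(size B).-1) (w * A`_(size B).-1).
  rewrite subrK Normc.normcM => h.
  have : normc w * normc A`_(size B).-1 <= normc w * normc (lead_coef B).
    by rewrite ler_wpM2l ?normc_ge0.
  by move=> h2; lra.
have s_eq : size (B - w *: A) = size B.
  apply/eqP; rewrite eqn_leq sBw /= leqNgt; apply/negP => s_lt.
  move: key; rewrite nth_default; last first.
    by move: s_lt; case: (size B).
  rewrite Normc.normc0 leNgt mulr_gt0 ?subr_gt0 //.
by split=> //; rewrite [X in _ <= normc X]lead_coefE s_eq.
Qed.

(* Along the segment t w, 0 <= t <= 1, no root of B - t w A can reach the imaginary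
   axis or come from infinity, so none enters the right half-plane. *)
Lemma dominated_sub_hurwitz A B w : dominated A B -> normc w < 1 ->
  hurwitz (B - w *: A).
Proof.
move=> dAB w1; have [hB sAB lAB yAB] := dAB.
have B0 := hurwitz_neq0 hB.
have lB : 0 < normc (lead_coef B) by rewrite normc_gt0 lead_coef_eq0.
have sB : (0 < size B)%N by rewrite size_poly_gt0.
have wt (t : R) : 0 <= t <= 1 -> normc (t%:C%C * w) <= normc w.
  move=> /andP[t0 t1]; rewrite Normc.normcM normc_toC ger0_norm //.
  by rewrite ler_piMl // normc_ge0.
pose Q (t : R) := B - (t%:C%C * w) *: A.
have Qdiff s t z : (Q s).[z] - (Q t).[z] = (t - s)%:C%C * (w * A.[z]).
  rewrite /Q !hornerE !rmorphB /=; ring.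
(* A root on the axis would give B(z) = t w A(z) with |t w| < 1 and B(z) nonzero, hence |B(z)| <
   |A(z)|. *)
have Qaxis t z : 0 <= t <= 1 -> root (Q t) z -> Rec z != 0.
  move=> t01 rz; apply/eqP; case: z rz => a y /[swap] /= -> rz.
  have := yAB y; move: rz; rewrite /Q rootE !hornerE subr_eq0 => /eqP Bz.
  have Bz0 : 0 < normc B.[(0 +i* y)%C].
    by rewrite normc_gt0; apply/negP => /hB /=; rewrite ltxx.
  rewrite leNgt => /negP; apply.
  have Az0 : 0 < normc A.[(0 +i* y)%C].
    rewrite normc_gt0; apply/eqP => A0; move: Bz0.
    by rewrite Bz A0 mulr0 Normc.normc0 ltxx.
  by rewrite Bz Normc.normcM gtr_pMl // (le_lt_trans (wt _ t01)).
suff : hurwitz (Q 1) by rewrite /Q rmorph1 mul1r.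
apply: (@interval_induction R (fun t => hurwitz (Q t))).
- by rewrite /Q rmorph0 mul0r scale0r subr0.
(* Closedness: for s < t the Hurwitz polynomial [Q s] has modulus at least [b] at [z], with [b]
   independent of [s], whereas its value there is (t - s) w A(z), which tends to 0. *)
- move=> t /andP[t_gt0 t_le1] IH z rz.
  have t01 : 0 <= t <= 1 by rewrite ltW.
  rewrite lt_neqAle (Qaxis _ _ t01 rz) /= leNgt; apply/negP => z_gt0.
  pose m := (size B).-1.
  pose b := (1 - normc w) * normc (lead_coef B) * Rec z ^+ m.
  have b_gt0 : 0 < b by rewrite /b !mulr_gt0 ?subr_gt0 // exprn_gt0.
  have lb s : 0 <= s < t -> b <= (t - s) * normc (w * A.[z]).
    move=> /andP[s0 st]; have s01 : 0 <= s <= 1 by rewrite s0 (le_trans (ltW st)).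
    have hs : hurwitz (Q s) by apply: IH; rewrite s0.
    have [|sQ lQ] := @dominated_lead A B (s%:C%C * w) dAB.
      exact: le_lt_trans (wt _ s01) w1.
    have := hurwitz_ge_Rec hs (ltW z_gt0); rewrite sQ -/m => h.
    have := Qdiff s t z; move/eqP: rz => ->; rewrite subr0 => Qs.
    have <- : normc (Q s).[z] = (t - s) * normc (w * A.[z]).
      by rewrite Qs Normc.normcM normc_toC ger0_norm // subr_ge0 ltW.
    apply: le_trans h; rewrite /b ler_wpM2r ?exprn_ge0 ?(ltW z_gt0) //.
    apply: le_trans lQ; rewrite ler_wpM2r ?normc_ge0 //.
    by rewrite lerD2l lerN2 wt.
  pose K := normc (w * A.[z]) + 1.
  have K_gt0 : 0 < K by rewrite /K ltr_wpDl // normc_ge0.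
  pose s := Num.max 0 (t - b / (2 * K)).
  have bK : 0 < b / (2 * K) by rewrite divr_gt0 // mulr_gt0.
  have st : 0 <= s < t by rewrite le_max lexx /= gt_max t_gt0 /= gtrBl.
  have := lb s st; apply/negP; rewrite -ltNge.
  have s_ge : t - s <= b / (2 * K).
    by have : t - b / (2 * K) <= s by [rewrite le_max lexx orbT]; lra.
  apply: le_lt_trans (_ : b / (2 * K) * K < b).
    apply: ler_pM => //; [|exact: normc_ge0|by rewrite lerDl].
    by rewrite subr_ge0; case/andP: st => _ /ltW.
  by rewrite invfM mulrA mulfVK ?gt_eqF // ltr_pdivrMr // ltr_pMr // ltr1n.
(* Openness: with m the degree of B, [Q t] is at least k (1 + |z|)^m and [w *: A] at most K (1 +
   |z|)^m where Re z >= 0, so moving [t] by less than k / (K + 1) creates no root there. The 1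
   guards against K = 0. *)
- move=> t t01 ht.
  have [|sQ _] := @dominated_lead A B (t%:C%C * w) dAB.
    exact: le_lt_trans (wt _ t01) w1.
  have [k k_gt0 kP] := hurwitz_growth ht.
  have [|K K_ge0 KP] := @poly_growth R (w *: A) (size B).-1.
    by rewrite prednK //; apply: leq_trans (size_scale_leq _ _) sAB.
  have K1 : 0 < K + 1 by rewrite ltr_wpDl.
  exists (k / (K + 1)) => [|s /andP[ts s1] sk z rz]; first exact: divr_gt0.
  have s01 : 0 <= s <= 1 by rewrite s1 (le_trans _ ts) //; case/andP: t01.
  rewrite ltNge; apply/negP => z_ge0.
  have := kP z z_ge0; rewrite sQ -/(Q t) leNgt => /negP; apply.
  have := Qdiff t s z; move/eqP: rz => ->; rewrite subr0 => ->.
  rewrite Normc.normcM normc_toC ger0_norm ?subr_ge0 // -hornerZ.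
  have p_gt0 : 0 < (1 + normc z) ^+ (size B).-1.
    by rewrite exprn_gt0 // ltr_pwDl // normc_ge0.
  apply: le_lt_trans (_ : (s - t) * (K * (1 + normc z) ^+ (size B).-1) < _).
    by rewrite ler_wpM2l ?subr_ge0.
  rewrite mulrA ltr_pM2r //; apply: le_lt_trans (_ : (s - t) * (K + 1) < _).
    by rewrite ler_wpM2l ?subr_ge0 // lerDl.
  by rewrite -ltr_pdivlMr.
Qed.

(** If |A'(z)| > |B'(z)| on the axis, then w = B'(z) / A'(z) has |w| < 1 and B' - w A' vanishes at
    z, although it is the derivative of the Hurwitz polynomial B - w A, hence Hurwitz. *)
Lemma dominated_deriv A B : (1 < size B)%N -> dominated A B ->
  dominated A^`() B^`().
Proof.
move=> sB dAB; have [hB sAB lAB yAB] := dAB.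
have sB' : size B^`() = (size B).-1 by rewrite size_deriv_num.
split.
- exact: hurwitz_deriv.
- rewrite sB' -ltnS prednK; last by case: (size B) sB.
  have [->|A0] := eqVneq A 0; first by rewrite deriv0 size_poly0 (ltn_trans _ sB).
  exact: leq_trans (lt_size_deriv A0) sAB.
- rewrite lead_coefE sB' !coef_deriv prednK; last by case: (size B) sB => [|[]].
  by rewrite !normcMn lerMn2r lAB orbT.
- move=> y; rewrite leNgt; apply/negP => lt.
  set z := (0 +i* y)%C in lt.
  have A0 : 0 < normc A^`().[z] by apply: le_lt_trans lt; apply: normc_ge0.
  pose w := B^`().[z] / A^`().[z].
  have w1 : normc w < 1.
    by rewrite Normc.normcM Normc.normcV ltr_pdivrMr // mul1r.
  have hw := dominated_sub_hurwitz dAB w1.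
  have [sw _] := dominated_lead dAB w1.
  have := @hurwitz_deriv R _ _ hw; rewrite sw => /(_ sB z).
  rewrite /z /= ltxx => h; suff : false by []; apply: h.
  rewrite rootE derivB derivZ !hornerE /w -/z divfK ?subrr //.
  by rewrite -normc_gt0.
Qed.

Lemma dominated_derivn A B k : (k < size B)%N -> dominated A B ->
  dominated A^`(k) B^`(k).
Proof.
elim: k => [//|k IH] kB dAB; rewrite !derivnS.
apply: dominated_deriv (IH (ltnW kB) dAB).
suff -> : size B^`(k) = (size B - k)%N by rewrite ltn_subRL addn1.
elim: k kB {IH} => [|k IH] kB; first by rewrite subn0.
by rewrite derivnS size_deriv_num IH ?subnS // ltnW.
Qed.

End Domination.

(** * Chebyshev polynomials *)

Lemma XsubC_divpK (F : fieldType) (W : {poly F}) (x : F) :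
  root W x -> W = (W %/ ('X - x%:P)) * ('X - x%:P).
Proof. by rewrite root_factor_theorem => /divpK. Qed.

Lemma horner_div_root (F : fieldType) (W : {poly F}) (x : F) :
  root W x -> (W %/ ('X - x%:P)).[x] = W^`().[x].
Proof.
move=> rW; rewrite {2}(XsubC_divpK rW) derivM derivXsubC !hornerE.
by rewrite subrr mulr0 add0r.
Qed.

(** W / (X - x) takes the value W'(x) at x and 0 at the other nodes, so both sides agree at more
    points than their degree. It is applied to W = (X^2 - 1) T' and to W = T. *)
Lemma lagrange_simple_roots (F : fieldType) (W q : {poly F}) (xs : seq F) :
  uniq xs -> (forall x, x \in xs -> root W x) ->
  (forall x, x \in xs -> W^`().[x] != 0) ->
  size W = (size xs).+1 -> (size q <= size xs)%N ->
  q = \sum_(x <- xs) (q.[x] / W^`().[x]) *: (W %/ ('X - x%:P)).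
Proof.
move=> uxs rW dW sW sq; apply/eqP; rewrite -subr_eq0; apply/eqP.
set S := \sum_(x <- xs) _.
have sS : (size S <= size xs)%N.
  apply: leq_trans (size_sum _ _ _) _.
  elim/big_ind: _ => // [m n|x _]; first by rewrite geq_max => -> ->.
  apply: leq_trans (size_scale_leq _ _) _.
  by rewrite size_divp ?polyXsubC_eq0 // size_XsubC sW subn1.
apply: (@roots_geq_poly_eq0 _ _ xs) => //.
  apply/allP => y yxs; rewrite rootE hornerD hornerN subr_eq0.
  rewrite /S horner_sum (bigD1_seq y) //= hornerZ horner_div_root ?rW // divfK ?dW //.
  rewrite big_seq_cond big1 ?addr0 // => x /andP[xxs xy].
  rewrite hornerZ; apply/eqP; rewrite mulf_eq0; apply/orP; right.
  have := rW y yxs; rewrite {1}(XsubC_divpK (rW x xxs)) rootM root_XsubC.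
  by rewrite eq_sym (negbTE xy) orbF.
apply: leq_trans (size_polyD _ _) _.
by rewrite size_polyN geq_max sq sS.
Qed.

Section Chebyshev.
Variable R : realType.
Implicit Types (n k : nat) (x t : R).

(** The addition formulas of cosine and sine as a joint recursion. At cos t the second component is
    sin (n t) / sin t: it is the usual Chebyshev polynomial of the second kind of index n - 1, and 0
    for n = 0. *)
Fixpoint chebTU n : {poly R} * {poly R} :=
  if n is m.+1 then
    let: (T, U) := chebTU m in
    ('X * T - (1 - 'X ^+ 2) * U, 'X * U + T)
  else (1, 0).

Definition chebT n := (chebTU n).1.
Definition chebU n := (chebTU n).2.

Lemma chebTS n : chebT n.+1 = 'X * chebT n - (1 - 'X ^+ 2) * chebU n.
Proof. by rewrite /chebT /chebU /=; case: (chebTU n). Qed.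

Lemma chebUS n : chebU n.+1 = 'X * chebU n + chebT n.
Proof. by rewrite /chebT /chebU /=; case: (chebTU n). Qed.

Lemma cheb_pell n : chebT n ^+ 2 + (1 - 'X ^+ 2) * chebU n ^+ 2 = 1.
Proof.
elim: n => [|n IH]; first by rewrite /chebT /chebU /=; ring.
rewrite chebTS chebUS -[RHS]IH; ring.
Qed.

Lemma cheb_pell_horner n x :
  (chebT n).[x] ^+ 2 + (1 - x ^+ 2) * (chebU n).[x] ^+ 2 = 1.
Proof.
rewrite -[RHS](hornerC 1 x) polyC1 -(cheb_pell n) hornerD horner_exp hornerM horner_exp.
by rewrite hornerD hornerN horner_exp hornerX hornerC.
Qed.

Lemma cheb_deriv n : (chebT n)^`() = n%:R * chebU n /\
  (1 - 'X ^+ 2) * (chebU n)^`() = 'X * chebU n - n%:R * chebT n.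
Proof.
elim: n => [|n [IHT IHU]].
  rewrite /chebT /chebU /= derivC deriv0; split; ring.
have dX2 : (1 - 'X ^+ 2 : {poly R})^`() = - 2%:R * 'X.
  by rewrite derivB derivC expr2 derivM derivX; ring.
rewrite chebTS chebUS derivB !derivM dX2 derivD derivM derivX IHT IHU -natr1.
split; first by ring.
transitivity ('X * ((1 - 'X ^+ 2) * (chebU n)^`())
              + (n%:R + 1) * (1 - 'X ^+ 2) * chebU n); first by ring.
rewrite IHU; ring.
Qed.

Lemma chebT_deriv n : (chebT n)^`() = n%:R * chebU n.
Proof. by case: (cheb_deriv n). Qed.

Lemma chebT_ode n : (1 - 'X ^+ 2) * (chebT n)^`(2)
  = 'X * (chebT n)^`() - (n ^ 2)%:R * chebT n.
Proof.
have [dT dU] := cheb_deriv n.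
rewrite derivnS derivn1 dT derivM -(polyC_natr _ n) derivC mul0r add0r.
by rewrite mulrCA dU polyC_natr natrX; ring.
Qed.

(** Chebyshev's differential equation differentiated k times. At 1 the left side vanishes, which
    leaves a recursion for the derivatives of T at 1. *)
Lemma chebT_ode_derivn n k : (1 - 'X ^+ 2) * (chebT n)^`(k.+2)
  = (2 * k + 1)%:R * 'X * (chebT n)^`(k.+1)
    - ((n ^ 2)%:R - (k ^ 2)%:R) * (chebT n)^`(k).
Proof.
elim: k => [|k IH].
  rewrite chebT_ode derivn1 derivn0; ring.
have := congr1 (@deriv R) IH.
have dX2 : (1 - 'X ^+ 2 : {poly R})^`() = - 2%:R * 'X.
  by rewrite derivB derivC expr2 derivM derivX; ring.
have dN m : (m%:R : {poly R})^`() = 0 by rewrite -polyC_natr derivC.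
rewrite derivM dX2 -derivnS derivB !derivM derivB derivX !dN -!derivnS.
move=> /(canRL (addKr _)) ->.
rewrite !natrX !natrD !natrM -natr1; ring.
Qed.

Lemma chebT1 n : (chebT n).[1] = 1.
Proof.
elim: n => [|n IH]; first by rewrite /chebT /= hornerC.
by rewrite chebTS !hornerE IH expr1n subrr mul0r; ring.
Qed.

(** For k = 0 the truncated predecessor yields [dfact 0], which is 1, in accordance with the
    convention (-1)!! = 1. *)
Lemma dfact_odd k : dfact (2 * k.+1).-1 = ((2 * k + 1) * dfact (2 * k).-1)%N.
Proof.
case: k => [//|k].
have -> : ((2 * k.+2).-1 = (2 * k + 1).+2)%N by lia.
have -> : ((2 * k.+1).-1 = 2 * k + 1)%N by lia.
by rewrite /dfact -/dfact; congr (_ * _)%N; lia.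
Qed.

Lemma chebT_derivn1 n k : (dfact (2 * k).-1)%:R * ((chebT n)^`(k)).[1]
  = \prod_(j < k) ((n ^ 2)%:R - (j ^ 2)%:R) :> R.
Proof.
elim: k => [|k IH]; first by rewrite big_ord0 derivn0 chebT1 mulr1.
rewrite big_ord_recr /= -IH dfact_odd natrM.
have := congr1 (fun p => p.[1]) (chebT_ode_derivn n k).
rewrite -!polyC_natr !hornerE expr1n subrr mul0r ?mulr1 => /eqP.
rewrite eq_sym subr_eq0 => /eqP h.
by rewrite mulrAC h; ring.
Qed.

Lemma chebT_derivn1_le n k : (k <= n)%N ->
  (dfact (2 * k).-1)%:R * ((chebT n)^`(k)).[1] <= (n ^ 2)%:R ^+ k :> R.
Proof.
move=> kn; rewrite chebT_derivn1 -[k in X in _ <= X]card_ord -prodr_const.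
apply: ler_prod => j _; rewrite subr_ge0 lerBlDr lerDl ler0n andbT ler_nat.
by rewrite leq_exp2r // (leq_trans (ltnW (ltn_ord j))).
Qed.

Lemma chebT_derivn1_ge0 n k : (k <= n)%N -> 0 <= ((chebT n)^`(k)).[1] :> R.
Proof.
move=> kn; rewrite -(@pmulr_rge0 _ (dfact (2 * k).-1)%:R); last first.
  elim: k {kn} => [|k IH]; first by rewrite ltr0n.
  by rewrite dfact_odd natrM mulr_gt0 // ltr0n addn1.
rewrite chebT_derivn1 prodr_ge0 // => j _; rewrite subr_ge0 ler_nat.
by rewrite leq_exp2r // (leq_trans (ltnW (ltn_ord j))).
Qed.

Lemma chebT_rec n : chebT n.+2 = 2%:R * 'X * chebT n.+1 - chebT n.
Proof. rewrite [LHS]chebTS chebUS chebTS; ring. Qed.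

Lemma size_chebT n : size (chebT n) = n.+1.
Proof.
suff [] : size (chebT n) = n.+1 /\ size (chebT n.+1) = n.+2 by [].
elim: n => [|n [IH0 IH1]].
  by rewrite chebTS /chebT /chebU /= mulr0 subr0 mulr1 size_poly1 size_polyX.
split=> //; rewrite chebT_rec.
have T0 : chebT n.+1 != 0 by rewrite -size_poly_eq0 IH1.
have sX : size (2%:R * 'X * chebT n.+1) = n.+3.
  rewrite -mulrA -polyC_natr mul_polyC size_scale ?pnatr_eq0 //.
  by rewrite mulrC size_mulX // IH1.
by rewrite size_polyDl ?size_polyN sX ?IH0.
Qed.

Lemma cheb_cos n t : (chebT n).[cos t] = cos (n%:R * t) /\
  (chebU n).[cos t] * sin t = sin (n%:R * t).
Proof.
elim: n => [|n [IHT IHU]].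
  by rewrite /chebT /chebU /= !hornerE ?mulr0n ?mul0r cos0 sin0.
have -> : n.+1%:R * t = n%:R * t + t by rewrite -natr1 mulrDl mul1r.
rewrite chebTS chebUS cosD sinD -IHT -IHU !hornerE.
rewrite -sin2cos2; split; ring.
Qed.

Lemma chebT_cos n t : (chebT n).[cos t] = cos (n%:R * t).
Proof. by case: (cheb_cos n t). Qed.

Definition cheb_angle n k : R := (2 * k + 1)%:R * (pi / (2 * n)%:R).
Definition cheb_roots n : seq R := [seq cos (cheb_angle n k) | k <- iota 0 n].
Definition cheb_extrema n : seq R :=
  [seq cos (k%:R * (pi / n%:R)) | k <- iota 0 n.+1].

Lemma cheb_angle_bound n k : (k < n)%N -> 0 < cheb_angle n k < pi.
Proof.
move=> kn; rewrite /cheb_angle mulr_gt0 ?ltr0n ?addn1 //=; last first.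
  by rewrite divr_gt0 ?pi_gt0 // ltr0n; lia.
rewrite mulrCA gtr_pMr ?pi_gt0 // ltr_pdivrMr ?mul1r ?ltr_nat ?ltr0n; lia.
Qed.

Lemma sin_natpi k : sin (k%:R * pi) = 0 :> R.
Proof.
elim: k => [|k IH]; first by rewrite mul0r sin0.
by rewrite -natr1 mulrDl mul1r sinD IH sinpi mul0r mulr0 addr0.
Qed.

Lemma cos_natpihalf k : cos ((2 * k + 1)%:R * (pi / 2)) = 0 :> R.
Proof.
rewrite natrD natrM mulrDl mul1r.
have -> : 2 * k%:R * (pi / 2) = k%:R * pi :> R by field.
by rewrite cosD cos_pihalf sin_natpi mulr0 mul0r subr0.
Qed.

Lemma size_cheb_roots n : size (cheb_roots n) = n.
Proof. by rewrite size_map size_iota. Qed.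

Lemma size_cheb_extrema n : size (cheb_extrema n) = n.+1.
Proof. by rewrite size_map size_iota. Qed.

Lemma uniq_cheb_roots n : uniq (cheb_roots n).
Proof.
rewrite map_inj_in_uniq ?iota_uniq // => i j.
rewrite !mem_iota /= !add0n => /cheb_angle_bound/andP[i0 ip].
move=> jn; have n0 : (0 < n)%N by lia.
move: jn => /cheb_angle_bound/andP[j0 jp].
have dn : pi / (2 * n)%:R != 0 :> R.
  by rewrite mulf_neq0 ?invr_eq0 ?gt_eqF ?pi_gt0 ?ltr0n; lia.
move=> /cos_inj; rewrite !in_itv /= !ltW // => /(_ isT isT)/(mulIf dn)/eqP.
by rewrite eqr_nat => /eqP; lia.
Qed.

Lemma uniq_cheb_extrema n : (0 < n)%N -> uniq (cheb_extrema n).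
Proof.
move=> n0; rewrite map_inj_in_uniq ?iota_uniq // => i j.
rewrite !mem_iota /= !add0n => ilt jlt.
have dn : pi / n%:R != 0 :> R.
  by rewrite mulf_neq0 ?invr_eq0 ?gt_eqF ?pi_gt0 ?ltr0n.
have b k : (k < n.+1)%N -> (0 : R) <= k%:R * (pi / n%:R) <= pi.
  move=> kn; rewrite mulr_ge0 ?ler0n ?divr_ge0 ?pi_ge0 //=.
  rewrite mulrCA ger_pMr ?pi_gt0 // ler_pdivrMr ?mul1r ?ler_nat ?ltr0n //.
move=> /cos_inj; rewrite !in_itv /= !b // => /(_ isT isT)/(mulIf dn)/eqP.
by rewrite eqr_nat => /eqP.
Qed.

Lemma cheb_root_root n r : r \in cheb_roots n -> (chebT n).[r] = 0.
Proof.
case/mapP => k; rewrite mem_iota add0n => /andP[_ kn] ->.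
rewrite chebT_cos /cheb_angle -[RHS](cos_natpihalf k); congr cos.
by rewrite natrM; field; rewrite pnatr_eq0; lia.
Qed.

Lemma cheb_root_bound n r : r \in cheb_roots n -> -1 < r < 1.
Proof.
case/mapP => k; rewrite mem_iota add0n => /andP[_ kn] ->.
have /andP[a0 ap] := cheb_angle_bound kn.
rewrite -cospi -cos0 !ltr_cos ?in_itv /= ?lexx ?pi_ge0 ?a0 ?ap ?ltW //.
Qed.

Lemma cheb_extrema_sqr n x : (0 < n)%N -> x \in cheb_extrema n ->
  (chebT n).[x] ^+ 2 = 1 /\ -1 <= x <= 1.
Proof.
move=> n0 /mapP[k _ ->]; rewrite cos_geN1 cos_le1 chebT_cos; split=> //.
rewrite cos2sin2.
have -> : n%:R * (k%:R * (pi / n%:R)) = k%:R * pi :> R.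
  by field; rewrite pnatr_eq0; lia.
by rewrite sin_natpi expr0n subr0.
Qed.

Lemma chebT_prod n :
  chebT n = lead_coef (chebT n) *: \prod_(r <- cheb_roots n) ('X - r%:P).
Proof.
apply: all_roots_prod_XsubC; first by rewrite size_chebT size_cheb_roots.
  by apply/allP => r /cheb_root_root h; apply/rootP.
by rewrite uniq_rootsE uniq_cheb_roots.
Qed.

(** By the Pell identity T and U have no common root, and T' = n U. *)
Lemma chebT_deriv_root_neq0 n r : (0 < n)%N -> (chebT n).[r] = 0 ->
  (chebT n)^`().[r] != 0.
Proof.
move=> n0 T0; rewrite chebT_deriv -polyC_natr !hornerE mulf_neq0 //.
  by rewrite pnatr_eq0; lia.
apply/eqP => U0; have := cheb_pell_horner n r.
rewrite T0 U0 !expr0n /= mulr0 addr0 => /eqP.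
by rewrite eq_sym oner_eq0.
Qed.

(* The nodes are the zeros of W = (X^2 - 1) T'; at a zero t of T the Lagrange basis
   derivatives are T'(t) (1 - t x) / ((t - x)^2 W'(x)), with W'(x) of the sign of T(x). *)
Lemma deriv_le_chebT_at_roots n (p : {poly R}) t : (0 < n)%N ->
  (size p <= n.+1)%N -> (forall x, -1 <= x <= 1 -> `|p.[x]| <= 1) ->
  -1 <= t <= 1 -> (chebT n).[t] = 0 ->
  `|p^`().[t]| <= `|(chebT n)^`().[t]|.
Proof.
move=> n0 sp p1 t1 Tt; set T := chebT n in Tt *.
pose W : {poly R} := ('X ^+ 2 - 1) * T^`().
have dW : W^`() = 'X * T^`() + (n ^ 2)%:R * T.
  have := chebT_ode n; rewrite -/T derivnS derivn1 => ode.
  rewrite /W derivM derivB derivC expr2 derivM derivX subr0.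
  rewrite -[_ * T^`()^`()]opprK -mulNr opprB -expr2 ode; ring.
have n2 : 0 < (n ^ 2)%:R :> R by rewrite ltr0n expn_gt0 n0.
have Wx x : W.[x] = (x ^+ 2 - 1) * T^`().[x] by rewrite /W !hornerE.
have dWx x : W^`().[x] = x * T^`().[x] + (n ^ 2)%:R * T.[x].
  by rewrite dW -polyC_natr !hornerE.
have T2 x : x \in cheb_extrema n -> T.[x] ^+ 2 = 1.
  by move=> /(cheb_extrema_sqr n0)[].
have rootW x : x \in cheb_extrema n -> root W x.
  move=> xe; apply/eqP; rewrite Wx.
  have := cheb_pell_horner n x; rewrite -/T T2 //.
  move=> /(canRL (addKr _)); rewrite addNr => /eqP; rewrite mulf_eq0 expf_eq0 /=.
  case/orP => [/eqP h|/eqP h]; first by rewrite -opprB h oppr0 mul0r.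
  by rewrite chebT_deriv hornerM h !mulr0.
(* At an interior extremum T' = 0 and W' = n^2 T. At an endpoint the differential equation gives x
   T' = n^2 T, hence W' = 2 n^2 T. *)
have WT x : x \in cheb_extrema n -> 0 < T.[x] * W^`().[x].
  move=> xe; have := rootW x xe; rewrite rootE Wx dWx mulf_eq0.
  case/orP => [|/eqP ->]; last first.
    by rewrite mulr0 add0r mulrCA -expr2 T2 // mulr1.
  move=> x2; have := congr1 (fun p => p.[x]) (chebT_ode n).
  rewrite -polyC_natr !hornerE -opprB (eqP x2) oppr0 mul0r -/T => /eqP.
  rewrite eq_sym subr_eq0 => /eqP ->.
  rewrite mulrDr mulrCA -expr2 T2 // mulr1; lra.
have dWn0 x : x \in cheb_extrema n -> W^`().[x] != 0.
  by move=> /WT h; apply/eqP => h0; move: h; rewrite h0 mulr0 ltxx.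
have T'0 : T^`() != 0.
  by rewrite -size_poly_eq0 size_deriv_num size_chebT /=; lia.
have sW : size W = (size (cheb_extrema n)).+1.
  rewrite size_cheb_extrema /W size_mul //; last first.
    by rewrite -size_poly_eq0 -polyC1 size_XnsubC.
  by rewrite -polyC1 size_XnsubC // size_deriv_num size_chebT; lia.
clearbody W.
have tx x : x \in cheb_extrema n -> t - x != 0.
  move=> /T2 h; rewrite subr_eq0; apply/eqP => tx; move: h; rewrite -tx Tt.
  by move=> /eqP; rewrite expr0n /= eq_sym oner_eq0.
have dQ x : x \in cheb_extrema n ->
    (W %/ ('X - x%:P))^`().[t] = T^`().[t] * (1 - t * x) / (t - x) ^+ 2.
  move=> xe; have eW := XsubC_divpK (rootW x xe).
  have e1 := congr1 (fun p => p.[t]) eW.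
  have e2 := congr1 (fun p => p^`().[t]) eW.
  move: e1 e2; rewrite /= derivM derivXsubC !hornerE Wx dWx Tt mulr0 addr0.
  set a := _.[t]; set b := _.[t]; set c := _.[t] => e1 e2.
  have t0 := tx x xe.
  have -> : c = ((t * a) * (t - x) - (t ^+ 2 - 1) * a) / (t - x) ^+ 2.
    by rewrite e1 e2; field.
  by field.
(* With these weights q'(t) is T'(t) times the sum of q(x) T(x) g(x). They are nonnegative, and the
   case q = T, where T(x)^2 = 1, shows that they sum to 1. *)
pose g x := (1 - t * x) / (t - x) ^+ 2 / (T.[x] * W^`().[x]).
have g0 x : x \in cheb_extrema n -> 0 <= g x.
  move=> xe; rewrite /g !mulr_ge0 ?invr_ge0 ?sqr_ge0 ?(ltW (WT x xe)) //.
  have [_ /andP[x1 x2]] := cheb_extrema_sqr n0 xe.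
  move/andP: t1 => [t1 t2]; nra.
have rep (q : {poly R}) : (size q <= n.+1)%N ->
    q^`().[t] = T^`().[t] * \sum_(x <- cheb_extrema n) q.[x] * T.[x] * g x.
  move=> sq; rewrite {1}(@lagrange_simple_roots _ W q (cheb_extrema n)) //; last first.
  - by rewrite size_cheb_extrema.
  - exact: uniq_cheb_extrema.
  rewrite raddf_sum /= horner_sum mulr_sumr big_seq [RHS]big_seq.
  apply: eq_bigr => x xe; rewrite derivZ hornerZ dQ // /g.
  have h1 := dWn0 x xe; have h2 := T2 x xe; have h3 := tx x xe.
  have h4 : T.[x] != 0.
    by apply/eqP => h; move: h2; rewrite h expr0n /= => /eqP; rewrite eq_sym oner_eq0.
  by field; rewrite h1 h3 h4.
have Tg : \sum_(x <- cheb_extrema n) g x = 1.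
  have := rep T; rewrite size_chebT => /(_ (leqnn _)).
  have T't := chebT_deriv_root_neq0 n0 Tt; rewrite -/T in T't.
  rewrite -{1}[T^`().[t]]mulr1 => /(mulfI T't) ->.
  by rewrite big_seq [RHS]big_seq; apply: eq_bigr => x /T2; rewrite expr2 => ->; rewrite mul1r.
rewrite rep // normrM ler_piMr ?normr_ge0 // -Tg.
apply: le_trans (ler_norm_sum _ _ _) _; rewrite big_seq [leRHS]big_seq.
apply: ler_sum => x xe; rewrite normrM (ger0_norm (g0 x xe)) normrM.
have [_ x1] := cheb_extrema_sqr n0 xe.
have -> : `|T.[x]| = 1.
  by apply/eqP; rewrite -(@eqrXn2 _ 2) ?normr_ge0 // expr1n -normrX T2 // normr1.
by rewrite mulr1 ler_piMl ?g0 ?p1.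
Qed.

End Chebyshev.

(** * Chebyshev polynomials on a vertical strip *)

Section PairProduct.
Variables (R : realDomainType) (s : R).
Hypothesis s_ge0 : 0 <= s.
Implicit Types (l : seq R).

Fixpoint pairprod l : R :=
  if l is a :: b :: l' then (s + a * b) * pairprod l' else 1.

Definition nneg l := all (fun a => 0 <= a) l.

Lemma pairprod_ge0 l : nneg l -> 0 <= pairprod l.
Proof.
suff [] : (nneg l -> 0 <= pairprod l) /\
   forall a, nneg (a :: l) -> 0 <= pairprod (a :: l) by [].
elim: l => [|b l [IH1 IH2]]; first by split.
split=> [|a /=/and3P[a0 b0 l0]]; first exact: IH2.
by rewrite mulr_ge0 ?IH1 // addr_ge0 // mulr_ge0.
Qed.

Lemma sorted_ge_eq l l' : sorted >=%R l -> sorted >=%R l' -> perm_eq l l' -> l = l'.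
Proof.
by apply: sorted_eq; [exact: ge_trans | exact: ge_anti].
Qed.

Lemma sorted_ge_cons2 a b l : b <= a -> all (fun x => x <= b) l ->
  sorted >=%R l -> sorted >=%R [:: a, b & l].
Proof.
by move=> ba /allP lb sl; rewrite /= ba path_min_sorted //; apply/allP => x /lb.
Qed.

(** Everything rests on (s + a d)(s + b e) - (s + a b)(s + d e) = s (a - e)(d - b). If [d] and [e]
    lead the list, the two largest of [a], [b], [d], [e] go in front and the other two are inserted
    into the tail by induction. *)
Lemma pairprod_insert l a b : sorted >=%R l -> nneg l -> 0 <= a -> 0 <= b ->
  ~~ odd (size l) ->
  exists l', [/\ sorted >=%R l', perm_eq l' [:: a, b & l] &
                 pairprod [:: a, b & l] <= pairprod l'].
Proof.
move: {2}(size l) (leqnn (size l)) => m.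
elim: m l a b => [|m IH] l a b.
  case: l => // _ _ _ a0 b0 _; have [ab|ba] := leP a b.
    exists [:: b; a]; rewrite /= ab [a * b]mulrC; split=> //.
    by apply/permP => P /=; ring.
  by exists [:: a; b]; rewrite /= (ltW ba); split.
wlog ba : a b / b <= a => [hw|].
  move=> sl ls ln a0 b0 o; have [ba|/ltW ab] := leP b a; first exact: hw.
  have [l' [l1 l2 l3]] := hw b a ab sl ls ln b0 a0 o.
  exists l'; split=> //; last by rewrite /= [a * b]mulrC.
  by apply: perm_trans l2 _; apply/permP => P /=; ring.
case: l => [|d [|e l]] // sl ls ln a0 b0.
  by move=> _; exists [:: a; b]; rewrite /= ba; split.
rewrite /= negbK => o.
move: ln => /= /and3P[d0 e0 ln].
move: ls => /= /andP[ed pl].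
have sle : sorted >=%R l by apply: path_sorted pl.
have le : all (fun x => x <= e) l by apply: order_path_min pl; apply: ge_trans.
have sz : (size l <= m)%N := ltnW sl.
(* [x1], [x2] is the new leading pair and [x3], [x4] the pair still to insert; as [e] bounds the
   tail, e <= x2 keeps the result sorted. *)
have step x1 x2 x3 x4 : 0 <= x1 -> 0 <= x2 -> 0 <= x3 -> 0 <= x4 ->
    x2 <= x1 -> x3 <= x2 -> x4 <= x2 -> e <= x2 ->
    perm_eq [:: x1; x2; x3; x4] [:: a; b; d; e] ->
    (s + a * b) * (s + d * e) <= (s + x1 * x2) * (s + x3 * x4) ->
    exists l', [/\ sorted >=%R l', perm_eq l' [:: a, b, d, e & l] &
                 pairprod [:: a, b, d, e & l] <= pairprod l'].
  move=> x10 x20 x30 x40 x21 x32 x42 ex2 pe le4.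
  have [l' [l1 l2 l3]] := IH l x3 x4 sz sle ln x30 x40 o.
  exists [:: x1, x2 & l']; split.
  - apply: sorted_ge_cons2 => //; rewrite (perm_all _ l2) /= x32 x42 /=.
    by apply/allP => x /(allP le) xe; apply: le_trans xe _.
  - apply: perm_trans (_ : perm_eq _ ([:: x1; x2; x3; x4] ++ l)) _.
      by rewrite /= !perm_cons.
    by rewrite (perm_cat2r l _ [:: a; b; d; e]).
  - rewrite /= mulrA; apply: le_trans (_ : (s + x1 * x2) * (s + x3 * x4) * pairprod l <= _).
      by rewrite ler_wpM2r // pairprod_ge0.
    rewrite -mulrA ler_wpM2l //; first by rewrite addr_ge0 // mulr_ge0.
have [db|bd] := leP d b.
  by apply: (step a b d e) => //; [exact: le_trans ed db| exact: le_trans ed db].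
have [ea|ae] := leP e a; last first.
  apply: (step d e a b) => //.
  - exact: ltW.
  - exact: le_trans ba (ltW ae).
  - by apply/permP => P /=; ring.
  - by rewrite mulrC.
have key : (s + a * b) * (s + d * e) <= (s + a * d) * (s + b * e).
  rewrite -subr_ge0.
  have -> : (s + a * d) * (s + b * e) - (s + a * b) * (s + d * e)
            = s * ((a - e) * (d - b)) by ring.
  by rewrite !mulr_ge0 // subr_ge0 // ltW.
have [da|ad] := leP d a.
  apply: (step a d b e) => //; first exact: ltW.
  by apply/permP => P /=; ring.
apply: (step d a b e) => //; first exact: ltW.
  by apply/permP => P /=; ring.
by rewrite [d * a]mulrC.
Qed.

(** Insertion sort: the tail is sorted by induction, then the head pair is inserted, and neither
    operation decreases the product. *)
Lemma pairprod_le_sorted l l' : nneg l -> ~~ odd (size l) ->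
  sorted >=%R l' -> perm_eq l l' -> pairprod l <= pairprod l'.
Proof.
move: {2}(size l) (leqnn (size l)) => m.
elim: m l l' => [|m IH] l l'.
  by case: l => // _ _ _ _; rewrite perm_sym => /perm_nilP ->.
case: l => [|a [|b l]] //.
  by move=> _ _ _ _; rewrite perm_sym => /perm_nilP ->.
move=> sz /= /and3P[a0 b0 ln]; rewrite negbK => o sl' pl'.
pose l1 := sort >=%R l.
have pl1 : perm_eq l l1 by rewrite perm_sym perm_sort.
have sl1 : sorted >=%R l1 by apply: sort_sorted; exact: ge_total.
have nl1 : nneg l1 by rewrite /nneg -(perm_all _ pl1).
have ol1 : ~~ odd (size l1) by rewrite -(perm_size pl1).
have [l2 [sl2 pl2 le2]] := pairprod_insert sl1 nl1 a0 b0 ol1.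
have -> : l' = l2.
  apply: sorted_ge_eq => //; apply: perm_trans (_ : perm_eq _ [:: a, b & l1]) _.
    by rewrite perm_sym; apply: perm_trans pl'; rewrite !perm_cons perm_sym.
  by rewrite perm_sym.
apply: le_trans le2; rewrite /= ler_wpM2l ?addr_ge0 ?mulr_ge0 //.
exact: IH (ltnW sz) ln o sl1 pl1.
Qed.

End PairProduct.

(** * Chebyshev products as products of chords *)

Section ChebyshevStrip.
Variable R : realType.
Implicit Types (x y f t : R) (n : nat).

Local Notation delta n := (pi / (2 * n)%:R : R).

(** 1 - cos u is half the squared chord of angle u on the unit circle. The indices run downwards so
    that the list is nonincreasing when 0 <= f <= [delta n]. *)
Definition chord_pairs n f : seq R :=
  flatten [seq [:: 1 - cos (f + cheb_angle R n k); 1 - cos (f - cheb_angle R n k)]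
          | k <- rev (iota 0 n)].

Lemma pairprod_chords n f s : pairprod s (chord_pairs n f)
  = \prod_(r <- cheb_roots R n) (s + (cos f - r) ^+ 2).
Proof.
rewrite /cheb_roots big_map /chord_pairs -[in RHS](revK (iota 0 n)).
rewrite big_rev /=; elim: (rev _) => [|k l IH] /=; first by rewrite big_nil.
rewrite big_cons IH; congr ((s + _) * _).
rewrite cosD cosB.
have := cos2Dsin2 f; have := cos2Dsin2 (cheb_angle R n k).
set a := cos f; set b := sin f; set c := cos _; set d := sin _ => h1 h2.
have -> : (1 - (a * c - b * d)) * (1 - (a * c + b * d))
   = (1 - a * c) ^+ 2 - b ^+ 2 * d ^+ 2 by ring.
have -> : b ^+ 2 = 1 - a ^+ 2 by rewrite -h2; ring.
have -> : d ^+ 2 = 1 - c ^+ 2 by rewrite -h1; ring.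
ring.
Qed.

Lemma nneg_chords n f : nneg (chord_pairs n f).
Proof.
rewrite /nneg /chord_pairs; elim: (rev _) => [//|k l IH] /=.
by rewrite !subr_ge0 !cos_le1.
Qed.

Lemma size_chords n f : size (chord_pairs n f) = n.*2.
Proof.
rewrite /chord_pairs -[in RHS](size_iota 0 n) -[in RHS]size_rev.
by elim: (rev _) => [//|k l IH] /=; rewrite IH.
Qed.

Lemma perm_chords n f : perm_eq (chord_pairs n f)
  ([seq 1 - cos (f + cheb_angle R n k) | k <- iota 0 n] ++
   [seq 1 - cos (f - cheb_angle R n k) | k <- iota 0 n]).
Proof.
rewrite perm_sym; apply: perm_trans (_ : perm_eq _
  ([seq 1 - cos (f + cheb_angle R n k) | k <- rev (iota 0 n)] ++
   [seq 1 - cos (f - cheb_angle R n k) | k <- rev (iota 0 n)])) _.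
  by apply: perm_cat; apply: perm_map; rewrite perm_sym perm_rev.
rewrite /chord_pairs; elim: (rev _) => [//|k l IH] /=.
apply/permP => P; move/permP: IH => /(_ P); rewrite /= !count_cat /=; lia.
Qed.

Lemma cheb_angleS n k : cheb_angle R n k.+1 = cheb_angle R n k + 2 * delta n.
Proof. rewrite /cheb_angle !natrD !natrM -natr1; ring. Qed.

(** The translation raises the index in the plus family and lowers it in the minus family. At the
    ends, the new minus entry of index 0 is the old plus entry of index 0, and the plus entry past
    the last index equals the last minus entry by 2 pi-periodicity. *)
Lemma chords_shift n f : (0 < n)%N ->
  perm_eq (chord_pairs n (f + 2 * delta n)) (chord_pairs n f).
Proof.
case: n => // n _; set n1 := n.+1.
apply: perm_trans (perm_chords _ _) _; rewrite perm_sym.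
apply: perm_trans (perm_chords _ _) _; rewrite perm_sym.
pose P k := 1 - cos (f + cheb_angle R n1 k).
pose M k := 1 - cos (f - cheb_angle R n1 k).
have eP k : 1 - cos (f + 2 * delta n1 + cheb_angle R n1 k) = P k.+1.
  by rewrite /P cheb_angleS; congr (1 - cos _); ring.
have eM k : 1 - cos (f + 2 * delta n1 - cheb_angle R n1 k.+1) = M k.
  by rewrite /M cheb_angleS; congr (1 - cos _); ring.
have eM0 : 1 - cos (f + 2 * delta n1 - cheb_angle R n1 0) = P 0%N.
  by rewrite /P /cheb_angle; congr (1 - cos _); rewrite muln0 add0n; ring.
have ePn : P n1 = M n.
  rewrite /P /M -[f - _ in RHS](subrK (pi *+ 2)) -[in RHS]cosD2pi.
  congr (1 - cos _); rewrite /cheb_angle /n1 -mulr_natr !natrD !natrM -!natr1.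
  have nz : n%:R + 1 != 0 :> R by rewrite natr1 pnatr_eq0.
  by field.
have -> : [seq 1 - cos (f + 2 * delta n1 + cheb_angle R n1 k) | k <- iota 0 n1]
          = [seq P k.+1 | k <- iota 0 n1] by apply: eq_map.
have -> : [seq 1 - cos (f + 2 * delta n1 - cheb_angle R n1 k) | k <- iota 0 n1]
          = P 0%N :: [seq M k | k <- iota 0 n].
  rewrite /n1 /= eM0 -[1%N]addn0 iotaDl -map_comp; congr (_ :: _).
  by apply: eq_map => k /=; rewrite eM.
have -> : [seq P k.+1 | k <- iota 0 n1] = rcons [seq P k.+1 | k <- iota 0 n] (M n).
  by rewrite /n1 -addn1 iotaD map_cat /= add0n -/n1 ePn cats1.
rewrite -/P -/M.
have -> : [seq 1 - cos (f + cheb_angle R n1 k) | k <- iota 0 n1]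
  = P 0%N :: [seq P k.+1 | k <- iota 0 n].
  rewrite /n1 /=; congr (_ :: _).
  by rewrite -[1%N]addn0 iotaDl -map_comp.
have -> : [seq 1 - cos (f - cheb_angle R n1 k) | k <- iota 0 n1]
  = rcons [seq M k | k <- iota 0 n] (M n).
  by rewrite {2}/n1 -addn1 iotaD map_cat /= add0n cats1.
by apply/permP => Q; rewrite -!cats1 /= !count_cat /=; ring.
Qed.

Lemma chords_shiftn n f k : (0 < n)%N ->
  perm_eq (chord_pairs n (f + 2 * delta n * k%:R)) (chord_pairs n f).
Proof.
move=> n0; elim: k => [|k IH]; first by rewrite mulr0 addr0.
rewrite -[k.+1%:R]natr1 mulrDr mulr1 addrA; exact: perm_trans (chords_shift _ n0) IH.
Qed.

Lemma ler_cos x y : 0 <= x -> x <= y -> y <= pi -> cos y <= cos x :> R.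
Proof.
move=> x0 xy yp; rewrite leNgt ltr_cos ?in_itv /= ?x0 ?yp ?(le_trans xy) //.
  by rewrite -leNgt.
by rewrite (le_trans x0).
Qed.

(** 1 - cos increases on [0, pi], where t_k - f <= t_k + f <= t_(k+1) - f, since consecutive angles
    t_k differ by 2 delta and f <= delta. *)
Lemma sorted_chords n f : 0 <= f <= delta n -> sorted >=%R (chord_pairs n f).
Proof.
move=> /andP[f0 fd]; rewrite /chord_pairs.
have d0 : 0 <= delta n by rewrite divr_ge0 ?pi_ge0.
have angle_ge k : delta n <= cheb_angle R n k.
  by rewrite /cheb_angle ler_peMl // ler1n addn1.
have angleS_le k m : (k < m)%N -> cheb_angle R n k + 2 * delta n <= cheb_angle R n m.
  move=> km; rewrite /cheb_angle -mulrDl ler_wpM2r // -natrD ler_nat; lia.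
have angle_top k : (k < n)%N -> cheb_angle R n k + delta n <= pi.
  move=> kn; rewrite /cheb_angle -[X in _ + X]mul1r -mulrDl natr1 mulrCA.
  rewrite ger_pMr ?pi_gt0 // ler_pdivrMr ?mul1r ?ler_nat ?ltr0n; lia.
suff: forall m, (m <= n)%N -> sorted >=%R (flatten
   [seq [:: 1 - cos (f + cheb_angle R n k); 1 - cos (f - cheb_angle R n k)]
     | k <- rev (iota 0 m)]) by apply.
elim=> [//|m IH] mn; rewrite -addn1 iotaD rev_cat /= add0n.
have top := angle_top m mn; have am := angle_ge m.
have flip k : cos (f - cheb_angle R n k) = cos (cheb_angle R n k - f).
  by rewrite -cosN opprB.
apply: sorted_ge_cons2; last exact: IH (ltnW mn).
  rewrite flip lerD2l lerN2; apply: ler_cos; lra.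
apply/allP => u /flattenP[l /mapP[k]]; rewrite mem_rev mem_iota add0n /= => km ->.
have ak := angle_ge k; have akm := angleS_le _ _ km.
by rewrite !inE => /orP[]/eqP ->; rewrite lerD2l lerN2 ?flip; apply: ler_cos; lra.
Qed.

(** Here cos f is at least every root, so each factor separately can only grow when cos f is
    replaced by 1. *)
Lemma chords_le n f y : 0 <= f <= delta n ->
  \prod_(r <- cheb_roots R n) (y ^+ 2 + (cos f - r) ^+ 2)
  <= \prod_(r <- cheb_roots R n) (y ^+ 2 + (1 - r) ^+ 2).
Proof.
move=> /andP[f0 fd]; rewrite big_seq [leRHS]big_seq; apply: ler_prod => r.
case/mapP => k; rewrite mem_iota add0n => /andP[_ kn] ->.
rewrite addr_ge0 ?sqr_ge0 //= lerD2l.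
have /andP[_ ap] := cheb_angle_bound R kn.
have fa : f <= cheb_angle R n k.
  apply: le_trans fd _; rewrite /cheb_angle ler_peMl ?ler1n ?addn1 //.
  by rewrite divr_ge0 ?pi_ge0.
have h1 := ler_cos f0 fa (ltW ap); have h2 := cos_le1 f.
by rewrite ler_pXn2r ?nnegrE //; lra.
Qed.

(* The factors are (x - cos t)^2 = (1 - cos (f + t)) (1 - cos (f - t)) with x = cos f.
   Translating f by 2 delta only permutes the numbers 1 - cos (f +- t), and the sorted
   pairing, which is the one met for 0 <= f <= delta, maximises the product. *)
Lemma chebT_strip n x y : (0 < n)%N -> -1 <= x <= 1 ->
  \prod_(r <- cheb_roots R n) (y ^+ 2 + (x - r) ^+ 2)
  <= \prod_(r <- cheb_roots R n) (y ^+ 2 + (1 - r) ^+ 2).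
Proof.
move=> n0 x1.
have d0 : 0 < delta n by rewrite divr_gt0 ?pi_gt0 // ltr0n; lia.
suff [f [k [cf fk]]] : exists f, exists k : nat, cos f = x /\
    (0 <= f - 2 * delta n * k%:R <= delta n \/ 0 <= f + 2 * delta n * k%:R <= delta n).
  rewrite -cf.
  have [g [g0 pg]] : exists g, 0 <= g <= delta n /\
      perm_eq (chord_pairs n f) (chord_pairs n g).
    case: fk => h.
      exists (f - 2 * delta n * k%:R); split=> //.
      by have := chords_shiftn (f - 2 * delta n * k%:R) k n0; rewrite subrK.
    exists (f + 2 * delta n * k%:R); split=> //.
    by rewrite perm_sym; apply: chords_shiftn.
  apply: le_trans (chords_le y g0); rewrite -!pairprod_chords.
  apply: pairprod_le_sorted; rewrite ?sqr_ge0 ?nneg_chords ?sorted_chords //.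
  by rewrite size_chords odd_double.
pose a := acos x.
have ca : cos a = x by rewrite acosK // in_itv.
have a0 : 0 <= a by rewrite acos_ge0.
(* Adding 1/2 before truncating makes [k] an integer nearest to a / (2 delta), so |a - 2 delta k| <=
   delta. The sign of the difference decides between f = a and f = - a. *)
have b0 : 0 <= a / (2 * delta n) + 1 / 2.
  by rewrite addr_ge0 ?divr_ge0 // ltW // mulr_gt0.
have /andP[k1 k2] := truncn_itv b0.
set k := Num.truncn _ in k1 k2.
have e : a = a / (2 * delta n) * (2 * delta n) by rewrite divfK // gt_eqF // mulr_gt0.
move: e k1 k2; set q := a / _; move: (delta n) d0 => d d0 e k1 k2.
rewrite -[k.+1%:R]natr1 in k2.
have m1 : 0 <= d * (q + 1 / 2 - k%:R) by rewrite mulr_ge0 ?(ltW d0) // subr_ge0.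
have m2 : 0 <= d * (k%:R + 1 - (q + 1 / 2)) by rewrite mulr_ge0 ?(ltW d0) // subr_ge0 ltW.
have [h|h] := leP 0 (a - 2 * d * k%:R).
  by exists a, k; split=> //; left; rewrite h /= e; lra.
exists (- a), k; split; first by rewrite cosN.
by right; apply/andP; split; [lra | rewrite e; lra].
Qed.

End ChebyshevStrip.

(** * V. A. Markov's inequality *)

Section Shift.
Variable F : idomainType.
Implicit Types (p : {poly F}) (a : F).

(** Moves the line Re z = a to the imaginary axis, where [dominated] makes its comparison. *)
Definition shiftp a p := p \Po ('X + a%:P).

Lemma horner_shiftp a p x : (shiftp a p).[x] = p.[x + a].
Proof. by rewrite /shiftp horner_comp hornerD hornerX hornerC. Qed.

Lemma deriv_shiftp a p : (shiftp a p)^`() = shiftp a p^`().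
Proof. by rewrite /shiftp deriv_comp derivD derivX derivC addr0 mulr1. Qed.

Lemma derivn_shiftp a p k : (shiftp a p)^`(k) = shiftp a p^`(k).
Proof. by elim: k => [//|k IH]; rewrite !derivnS IH deriv_shiftp. Qed.

Lemma size_shiftp a p : size (shiftp a p) = size p.
Proof. by rewrite /shiftp size_comp_poly2 // size_XaddC. Qed.

Lemma lead_coef_shiftp a p : lead_coef (shiftp a p) = lead_coef p.
Proof.
rewrite /shiftp lead_coef_comp ?size_XaddC //.
by rewrite lead_coefXaddC expr1n mulr1.
Qed.

Lemma coef_shiftp a p n : (size p <= n.+1)%N -> (shiftp a p)`_n = p`_n.
Proof.
rewrite leq_eqVlt => /predU1P[sp|sp].
  have := lead_coef_shiftp a p.
  by rewrite !lead_coefE size_shiftp sp.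
by rewrite !nth_default // size_shiftp.
Qed.

End Shift.

Section Markov.
Variable R : realType.
Implicit Types (n k : nat) (x y : R) (p : {poly R}).

Local Notation T := (chebT R).
Local Notation U := (chebU R).
Local Notation polyToC := (map_poly (real_complex R)).

Lemma chebT_le1 n x : -1 <= x <= 1 -> `|(T n).[x]| <= 1.
Proof.
move=> /andP[x1 x2]; rewrite -(@ler_pXn2r _ 2) ?nnegrE ?normr_ge0 //.
rewrite real_normK ?num_real // expr1n -(cheb_pell_horner n x) lerDl.
by rewrite mulr_ge0 ?sqr_ge0 //; nra.
Qed.

Lemma chebU_le n x : -1 <= x <= 1 -> `|(U n).[x]| <= n%:R.
Proof.
move=> x1; elim: n => [|n IH]; first by rewrite /chebU /= hornerC normr0.
rewrite chebUS hornerD hornerM hornerX -natr1; apply: le_trans (ler_normD _ _) _.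
rewrite lerD ?chebT_le1 //; apply: le_trans IH.
by rewrite normrM ler_piMl ?normr_ge0 // ler_norml.
Qed.

Lemma chebU1 n : (U n).[1] = n%:R.
Proof.
elim: n => [|n IH]; first by rewrite /chebU /= hornerC.
by rewrite chebUS hornerD hornerM hornerX IH chebT1 mul1r natr1.
Qed.

Lemma chebT_deriv_le n x : -1 <= x <= 1 -> `|(T n)^`().[x]| <= (T n)^`().[1].
Proof.
move=> x1; rewrite chebT_deriv -polyC_natr !hornerM !hornerC chebU1.
by rewrite normrM ger0_norm ?ler0n // ler_wpM2l ?ler0n // chebU_le.
Qed.

Lemma chebTC_prod n : polyToC (T n)
  = (lead_coef (T n))%:C%C *: \prod_(r <- cheb_roots R n) ('X - (r%:C%C)%:P).
Proof.
rewrite {1}chebT_prod map_polyZ rmorph_prod /=; congr (_ *: _).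
by apply: eq_bigr => r _; rewrite rmorphB /= map_polyX map_polyC.
Qed.

Lemma chebTC_hurwitz n : hurwitz (shiftp 1 (polyToC (T n))).
Proof.
move=> z; rewrite rootE horner_shiftp -rootE chebTC_prod rootZ; last first.
  by rewrite -[0]/(0%:C%C) (inj_eq (@complexI R)) lead_coef_eq0 -size_poly_eq0 size_chebT.
rewrite -(big_map (fun r => r%:C%C) predT (fun r => 'X - r%:P)) root_prod_XsubC.
case/mapP => r /cheb_root_bound/andP[_ r1]; case: z => a b [] /=.
by move=> *; lra.
Qed.

Lemma normc_sqr_inj (z w : R[i]) : normc z ^+ 2 <= normc w ^+ 2 -> normc z <= normc w.
Proof. by rewrite ler_pXn2r ?nnegrE ?normc_ge0. Qed.

(* w |-> T(x + w) with the roots on the right of the imaginary axis reflected to its left: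
   the modulus on the axis does not change, but the terms of the logarithmic derivative
   now have real and imaginary parts of constant sign. *)
Definition reflected_chebT n x : {poly R[i]} := (lead_coef (T n))%:C%C *:
  \prod_(r <- [seq (- `|x - r|)%:C%C | r <- cheb_roots R n]) ('X - r%:P).

Lemma normc_reflected_chebT n x y :
  normc (reflected_chebT n x).[(0 +i* y)%C] = normc (polyToC (T n)).[(x +i* y)%C].
Proof.
rewrite /reflected_chebT chebTC_prod !hornerZ !Normc.normcM !horner_prod !normc_prod.
congr (_ * _); rewrite big_map; apply: eq_bigr => r _; rewrite !hornerXsubC /=.
congr Num.sqrt; rewrite !subr0 add0r opprK.
by rewrite real_normK ?num_real.
Qed.

(** The leading coefficients agree, and on the axis the squared moduli are, up to a common factor,
    the two products compared by [chebT_strip]. *)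
Lemma reflected_chebT_dominated n x : (0 < n)%N -> -1 <= x <= 1 ->
  dominated (reflected_chebT n x) (shiftp 1 (polyToC (T n))).
Proof.
move=> n0 x1.
have c0 : lead_coef (T n) != 0 by rewrite lead_coef_eq0 -size_poly_eq0 size_chebT.
have cC : (lead_coef (T n))%:C%C != 0 by rewrite -[0]/(0%:C%C) (inj_eq (@complexI R)).
have sR : size (reflected_chebT n x) = n.+1.
  by rewrite size_scale // size_prod_XsubC size_map size_cheb_roots.
have sT : size (shiftp 1 (polyToC (T n))) = n.+1.
  by rewrite size_shiftp size_map_poly size_chebT.
split.
- exact: chebTC_hurwitz.
- by rewrite sR sT.
- rewrite sT /= lead_coef_shiftp lead_coef_map.
  have -> : (reflected_chebT n x)`_n = lead_coef (reflected_chebT n x).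
    by rewrite lead_coefE sR.
  rewrite lead_coefZ; set q := \prod_(r <- _) _.
  by have /monicP -> : q \is monic by [exact: monic_prod_XsubC]; rewrite mulr1.
move=> y; rewrite normc_reflected_chebT horner_shiftp !chebTC_prod !hornerZ.
rewrite !Normc.normcM ler_wpM2l ?normc_ge0 //; apply: normc_sqr_inj.
rewrite !horner_prod !normc_prod -!prodrXl.
have e (a r : R) : normc ('X - (r%:C%C)%:P).[(a +i* y)%C] ^+ 2 = y ^+ 2 + (a - r) ^+ 2.
  by rewrite hornerXsubC normc_sqr /= subr0 addrC.
have -> : (0 +i* y)%C + 1 = (1 +i* y)%C by apply/eqP; rewrite eq_complex /= add0r addr0 !eqxx.
under eq_bigr do rewrite e.
under [leRHS]eq_bigr do rewrite e.
exact: chebT_strip.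
Qed.

Lemma cheb_lagrange n p : (0 < n)%N -> (size p <= n.+1)%N ->
  p^`() = \sum_(r <- cheb_roots R n)
    (p^`().[r] / (T n)^`().[r]) *: (T n %/ ('X - r%:P)).
Proof.
move=> n0 sp; apply: lagrange_simple_roots.
- exact: uniq_cheb_roots.
- by move=> r /cheb_root_root h; apply/rootP.
- by move=> r /cheb_root_root; apply: chebT_deriv_root_neq0.
- by rewrite size_chebT size_cheb_roots.
- by rewrite size_cheb_roots size_deriv_num; case: (size p) sp.
Qed.

Lemma cheb_lagrange_coef_le1 n p : (0 < n)%N -> (size p <= n.+1)%N ->
  (forall x, -1 <= x <= 1 -> `|p.[x]| <= 1) ->
  forall r, r \in cheb_roots R n -> `|p^`().[r] / (T n)^`().[r]| <= 1.
Proof.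
move=> n0 sp p1 r rr; have T0 := cheb_root_root rr.
have := chebT_deriv_root_neq0 n0 T0; rewrite -normr_gt0 => d0.
rewrite normrM normfV ler_pdivrMr // mul1r.
apply: deriv_le_chebT_at_roots => //.
by have /andP[h1 h2] := cheb_root_bound rr; rewrite !ltW.
Qed.

Lemma Rec_inv (a b : R) : Rec (a +i* b)%C^-1 = a / (a ^+ 2 + b ^+ 2).
Proof. by []. Qed.

Lemma Imc_inv (a b : R) : Imc (a +i* b)%C^-1 = - (b / (a ^+ 2 + b ^+ 2)).
Proof. by []. Qed.

(** p' / T is the sum of lambda_r / (z - r) with |lambda_r| <= 1. Its real and imaginary parts are
    bounded separately by those of the logarithmic derivative of [reflected_chebT], where no
    cancellation occurs; the derivative of that polynomial is dominated by T'(1 + .). *)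
Lemma markov_first n p x y : (0 < n)%N -> (size p <= n.+1)%N ->
  (forall x, -1 <= x <= 1 -> `|p.[x]| <= 1) -> -1 <= x <= 1 ->
  normc (polyToC p^`()).[(x +i* y)%C] <= normc (polyToC (T n)^`()).[(1 +i* y)%C].
Proof.
move=> n0 sp p1 x1; set z := (x +i* y)%C.
have lam := cheb_lagrange_coef_le1 n0 sp p1.
have [/mapP[r rr zr]|zL] := boolP (z \in [seq r%:C%C | r <- cheb_roots R n]).
  case: zr => xr y0; rewrite /z y0 xr !complexr0 !horner_map !normc_toC.
  apply: le_trans (_ : `|(T n)^`().[r]| <= _).
    apply: deriv_le_chebT_at_roots => //; last exact: cheb_root_root.
    by rewrite -xr.
  apply: le_trans (ler_norm _); apply: chebT_deriv_le.
  by rewrite -xr.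
have [_ _ _ /(_ y)] : dominated (reflected_chebT n x)^`() (shiftp 1 (polyToC (T n)))^`().
  apply: dominated_deriv (reflected_chebT_dominated n0 x1).
  by rewrite size_shiftp size_map_poly size_chebT.
rewrite deriv_shiftp horner_shiftp deriv_map.
have -> : (0 +i* y)%C + 1 = (1 +i* y)%C by apply/eqP; rewrite eq_complex /= add0r addr0 !eqxx.
apply: le_trans.
pose N r := (x - r) ^+ 2 + y ^+ 2.
have N_gt0 r : r \in cheb_roots R n -> 0 < N r.
  move=> rr; rewrite lt_def addr_ge0 ?sqr_ge0 // andbT.
  rewrite paddr_eq0 ?sqr_ge0 // !expf_eq0 /= subr_eq0.
  apply: contra zL => /andP[/eqP xr /eqP y0]; apply/mapP; exists r => //.
  by rewrite /z xr y0.
have pz : (polyToC p^`()).[z] = (polyToC (T n)).[z] *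
    \sum_(r <- cheb_roots R n) (p^`().[r] / (T n)^`().[r])%:C%C * (z - r%:C%C)^-1.
  rewrite {1}(cheb_lagrange n0 sp) rmorph_sum /= horner_sum mulr_sumr.
  rewrite big_seq [RHS]big_seq; apply: eq_bigr => r rr.
  rewrite map_polyZ hornerZ mulrCA; congr (_ * _).
  have zr : z - r%:C%C != 0.
    by rewrite subr_eq0; apply: contra zL => /eqP ->; apply: map_f.
  have rT : root (T n) r by apply/rootP; exact: cheb_root_root.
  rewrite {2}(XsubC_divpK rT) rmorphM hornerM /= rmorphB /= map_polyX map_polyC.
  by rewrite hornerXsubC mulfK.
have Rz : (reflected_chebT n x)^`().[(0 +i* y)%C] = (reflected_chebT n x).[(0 +i* y)%C] *
    \sum_(r <- cheb_roots R n) (`|x - r| +i* y)%C^-1.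
  rewrite /reflected_chebT derivZ !hornerZ horner_deriv_prod_XsubC; last first.
    apply/mapP => -[r rr [h1 h2]]; have := N_gt0 r rr.
    rewrite /N h2 -(real_normK (num_real (x - r))).
    have -> : `|x - r| = 0 by move: h1; lra.
    by rewrite expr0n addr0 ltxx.
  rewrite mulrA; congr (_ * _); rewrite big_map; apply: eq_bigr => r _; congr (_^-1).
  by apply/eqP; rewrite eq_complex /= add0r opprK subr0 !eqxx.
rewrite pz Rz !Normc.normcM normc_reflected_chebT ler_wpM2l ?normc_ge0 //.
have zr r : z - r%:C%C = ((x - r) +i* y)%C.
  by apply/eqP; rewrite eq_complex /= subr0 !eqxx.
have abs_sum (g h : R -> R) : (forall r, r \in cheb_roots R n -> `|g r| <= h r) ->
    (\sum_(r <- cheb_roots R n) g r) ^+ 2 <= (\sum_(r <- cheb_roots R n) h r) ^+ 2.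
  move=> gh; have h_ge0 : 0 <= \sum_(r <- cheb_roots R n) h r.
    by rewrite big_seq sumr_ge0 // => r /gh; apply: le_trans; apply: normr_ge0.
  rewrite -(real_normK (num_real _)) ler_pXn2r ?nnegrE ?normr_ge0 //.
  apply: le_trans (ler_norm_sum _ _ _) _; rewrite big_seq [leRHS]big_seq.
  exact: ler_sum.
apply: normc_le; rewrite !Rec_sum !Imc_sum; apply: lerD.
  apply: abs_sum => r rr; rewrite zr Rec_inv real_normK ?num_real //.
  set l := p^`().[r] / (T n)^`().[r].
  have -> : Rec (l%:C%C * ((x - r) +i* y)%C^-1) = l * ((x - r) / N r).
    by rewrite /= mul0r subr0.
  rewrite normrM [`|_ / N r|]normrM normfV (gtr0_norm (N_gt0 r rr)) ler_piMl ?lam //.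
  by rewrite divr_ge0 ?normr_ge0 ?ltW ?N_gt0.
rewrite -[leRHS]sqrrN -sumrN.
rewrite -[leRHS](real_normK (num_real _)).
(* The factor y comes out of every term and leaves positive coefficients, so the absolute value
   passes inside the sum. *)
have -> : `|\sum_(r <- cheb_roots R n) - Imc (`|x - r| +i* y)%C^-1| =
          \sum_(r <- cheb_roots R n) `|y| / N r.
  transitivity `|y * \sum_(r <- cheb_roots R n) (N r)^-1|.
    rewrite mulr_sumr; congr `|_|; apply: eq_bigr => r _.
    by rewrite Imc_inv opprK real_normK ?num_real.
  rewrite normrM [X in _ * X]ger0_norm ?mulr_sumr //.
  by rewrite big_seq sumr_ge0 // => r rr; rewrite invr_ge0 ltW ?N_gt0.
apply: abs_sum => r rr; rewrite zr.
set l := p^`().[r] / (T n)^`().[r]; have -> : Imc (l%:C%C * ((x - r) +i* y)%C^-1) = l * - (y / N r).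
  by rewrite -Imc_inv /= mul0r addr0.
rewrite normrM normrN [`|y / N r|]normrM normfV (gtr0_norm (N_gt0 r rr)) ler_piMl ?lam //.
by rewrite divr_ge0 ?normr_ge0 ?ltW ?N_gt0.
Qed.

(** Every T / (X - r) has the leading coefficient of T, and the n interpolation coefficients are at
    most 1 in modulus. This supplies the condition at infinity in [dominated]. *)
Lemma coef_deriv_le_chebT n p : (0 < n)%N -> (size p <= n.+1)%N ->
  (forall x, -1 <= x <= 1 -> `|p.[x]| <= 1) ->
  `|p^`()`_n.-1| <= `|lead_coef (T n)^`()|.
Proof.
move=> n0 sp p1; rewrite lead_coefE size_deriv_num size_chebT /=.
rewrite !coef_deriv prednK // !normrMn lerMn2r; apply/orP; right.
have -> : (T n)`_n = lead_coef (T n) by rewrite lead_coefE size_chebT.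
have := congr1 (fun q : {poly R} => q`_n.-1) (cheb_lagrange n0 sp).
rewrite /= coef_deriv prednK // coef_sum.
have c r : r \in cheb_roots R n -> (T n %/ ('X - r%:P))`_n.-1 = lead_coef (T n).
  move=> rr; have rT : root (T n) r by apply/rootP; exact: cheb_root_root.
  rewrite {2}(XsubC_divpK rT) lead_coefM lead_coefXsubC mulr1 lead_coefE.
  by rewrite size_divp ?polyXsubC_eq0 // size_XsubC size_chebT subn1.
move=> e; have : `|p`_n *+ n| <= `|lead_coef (T n)| *+ n.
  rewrite e; apply: le_trans (ler_norm_sum _ _ _) _.
  rewrite -[X in _ *+ X](size_cheb_roots R n) -iter_addr_0 -count_predT -big_const_seq.
  rewrite big_seq [leRHS]big_seq; apply: ler_sum => r rr.
  rewrite coefZ c // normrM ler_piMl ?normr_ge0 //.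
  exact: cheb_lagrange_coef_le1.
by rewrite normrMn lerMn2r => /orP[|//]; rewrite eqn0Ngt n0.
Qed.

(** Domination of p'(x + .) by T'(1 + .) passes to k - 1 further derivatives, and the conclusion is
    read off at the origin of the imaginary axis. *)
Lemma markov_brothers n k p x : (0 < k <= n)%N -> (size p <= n.+1)%N ->
  (forall x, -1 <= x <= 1 -> `|p.[x]| <= 1) -> -1 <= x <= 1 ->
  `|p^`(k).[x]| <= (T n)^`(k).[1].
Proof.
move=> /andP[k0 kn] sp p1 x1; have n0 : (0 < n)%N by lia.
have sT : size (shiftp 1 (polyToC (T n)^`())) = n.
  by rewrite size_shiftp size_map_poly size_deriv_num size_chebT.
have d : dominated (shiftp x%:C%C (polyToC p^`())) (shiftp 1 (polyToC (T n)^`())).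
  split.
  - rewrite -deriv_map -deriv_shiftp; apply: hurwitz_deriv; last exact: chebTC_hurwitz.
    by rewrite size_shiftp size_map_poly size_chebT.
  - by rewrite sT size_shiftp size_map_poly size_deriv_num; case: (size p) sp.
  - rewrite sT lead_coef_shiftp lead_coef_map coef_shiftp; last first.
      by rewrite prednK // size_map_poly size_deriv_num; case: (size p) sp.
    by rewrite coef_map !normc_toC coef_deriv_le_chebT.
  - move=> y; rewrite !horner_shiftp.
    have e (a : R) : (0 +i* y)%C + a%:C%C = (a +i* y)%C.
      by apply/eqP; rewrite eq_complex /= add0r addr0 !eqxx.
    by rewrite -[1]/(1%:C%C) !e; apply: markov_first.
have kT : (k.-1 < size (shiftp 1%R (polyToC (T n)^`())))%N by rewrite sT prednK.
have [_ _ _ /(_ 0)] := dominated_derivn kT d.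
rewrite !derivn_shiftp !horner_shiftp !derivn_map -!derivSn !prednK //.
rewrite !complexr0 -[1]/(1%:C%C) -!rmorphD !horner_map !normc_toC !add0r.
by rewrite [X in _ <= X]ger0_norm // chebT_derivn1_ge0.
Qed.

End Markov.

(** * Polynomials bounded at the integers *)

Lemma derivn_comp_affine (F : comNzRingType) (p : {poly F}) (a b : F) k :
  (p \Po (a *: 'X + b%:P))^`(k) = a ^+ k *: (p^`(k) \Po (a *: 'X + b%:P)).
Proof.
elim: k => [|k IH]; first by rewrite expr0 scale1r.
rewrite !derivnS IH derivZ deriv_comp derivD derivZ derivX derivC addr0.
by rewrite -scalerAr mulr1 scalerA exprSr.
Qed.

(** An affine map carries [-1, 1] onto [0, L], and each derivative contributes a factor 2 / L. *)
Lemma markov_brothers_interval (R : realType) n k (q : {poly R}) (L M x : R) :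
  (0 < k <= n)%N -> (size q <= n.+1)%N -> 0 < L -> 0 < M ->
  (forall x, 0 <= x <= L -> `|q.[x]| <= M) -> 0 <= x <= L ->
  `|q^`(k).[x]| <= M * (2 / L) ^+ k * (chebT R n)^`(k).[1].
Proof.
move=> kn sq L0 M0 qM /andP[x0 xL].
pose p := M^-1 *: (q \Po ((L / 2) *: 'X + (L / 2)%:P)).
pose u := 2 / L * x - 1.
have pu t : p.[t] = M^-1 * q.[L / 2 * t + L / 2].
  by rewrite hornerZ horner_comp hornerD hornerZ hornerX hornerC.
have L2 : L / 2 != 0 by rewrite mulf_neq0 ?gt_eqF // invr_gt0.
have size_affine : size ((L / 2) *: 'X + (L / 2)%:P) = 2.
  rewrite size_polyDl size_scale ?size_polyX //.
  exact: leq_ltn_trans (size_polyC_leq1 _) _.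
have sp : (size p <= n.+1)%N.
  by rewrite (leq_trans (size_scale_leq _ _)) // size_comp_poly2.
have p1 t : -1 <= t <= 1 -> `|p.[t]| <= 1.
  move=> /andP[t1 t2]; rewrite pu normrM normfV (gtr0_norm M0) mulrC.
  rewrite ler_pdivrMr // mul1r; apply: qM; apply/andP; split; nra.
have u1 : -1 <= u <= 1.
  have h1 : 0 <= 2 / L * x by rewrite mulr_ge0 // divr_ge0 // ltW.
  have h2 : 2 / L * x <= 2 by rewrite mulrAC ler_pdivrMr // ler_pM2l.
  by rewrite /u; apply/andP; split; lra.
have := markov_brothers kn sp p1 u1.
rewrite /p derivnZ derivn_comp_affine !hornerZ horner_comp hornerD hornerZ hornerX hornerC.
have -> : L / 2 * u + L / 2 = x by rewrite /u; field; rewrite gt_eqF.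
have Lk : 0 < (L / 2) ^+ k by rewrite exprn_gt0 // divr_gt0.
rewrite !normrM normfV (gtr0_norm M0) (gtr0_norm Lk) mulrA => h.
have c0 : 0 < M^-1 * (L / 2) ^+ k by rewrite mulr_gt0 ?invr_gt0.
move: h; rewrite mulrC -ler_pdivlMr // => /le_trans; apply.
by rewrite invfM invrK mulrC -exprVn invf_div.
Qed.

(** A negative value at [t] would, by the mean value theorem, make g' negative somewhere before [t]
    and positive somewhere after it, hence g'' positive in between. *)
Lemma concave_poly_ge0 (R : rcfType) (g : {poly R}) (a b t : R) :
  (forall x, a <= x <= b -> g^`(2).[x] <= 0) -> 0 <= g.[a] -> 0 <= g.[b] ->
  a <= t <= b -> 0 <= g.[t].
Proof.
move=> g2 ga gb /andP[ta tb]; rewrite leNgt; apply/negP => gt0.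
have lta : a < t.
  by rewrite lt_neqAle ta andbT; apply/eqP => e; move: gt0; rewrite -e ltNge ga.
have ltb : t < b.
  by rewrite lt_neqAle tb andbT; apply/eqP => e; move: gt0; rewrite e ltNge gb.
have [c1 /[!in_itv] /= /andP[c1a c1t] e1] := poly_mvt g lta.
have [c2 /[!in_itv] /= /andP[c2t c2b] e2] := poly_mvt g ltb.
have c12 : c1 < c2 by apply: lt_trans c2t.
have [c3 /[!in_itv] /= /andP[c31 c32] e3] := poly_mvt g^`() c12.
have d1 : g^`().[c1] < 0.
  by rewrite -(@pmulr_llt0 _ (t - a)) ?subr_gt0 // -e1; lra.
have d2 : 0 < g^`().[c2].
  by rewrite -(@pmulr_lgt0 _ (b - t)) ?subr_gt0 // -e2; lra.
have : g^`()^`().[c3] * (c2 - c1) <= 0.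
  rewrite mulr_le0_ge0 ?subr_ge0 ?(ltW c12) //.
  by have := g2 c3; rewrite derivnS derivn1; apply; apply/andP; split; lra.
by rewrite -e3; lra.
Qed.

(** For h = f or h = - f, adding to m - h the parabola K/2 (x - a)(a + 1 - x), of second derivative
    -K and maximum K/8, gives a concave function that is nonnegative at both ends. *)
Lemma unit_interval_bound (R : rcfType) (f : {poly R}) (a t K m : R) :
  (forall x, a <= x <= a + 1 -> `|f^`(2).[x]| <= K) -> `|f.[a]| <= m ->
  `|f.[a + 1]| <= m -> a <= t <= a + 1 -> `|f.[t]| <= m + K / 8.
Proof.
suff half (h : {poly R}) : (forall x, a <= x <= a + 1 -> `|h^`(2).[x]| <= K) ->
    `|h.[a]| <= m -> `|h.[a + 1]| <= m -> a <= t <= a + 1 -> h.[t] <= m + K / 8.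
  move=> f2 fa fb tab; rewrite ler_norml half // andbT.
  rewrite -lerN2 opprK -hornerN; apply: half; rewrite ?hornerN ?normrN // => x xab.
  by rewrite derivnN hornerN normrN f2.
move=> h2 ha hb tab; have /andP[ta tb] := tab.
pose g := m%:P - h + (K / 2) *: (('X - a%:P) * ((a + 1)%:P - 'X)).
have gx x : g.[x] = m - h.[x] + K / 2 * ((x - a) * (a + 1 - x)).
  by rewrite /g !hornerE.
have g2 : g^`(2) = - h^`(2) - K%:P.
  rewrite /g !derivnS !derivn0 !(derivD, derivN, derivZ, derivM, derivC, derivX).
  rewrite !sub0r !subr0 !(mul1r, mulr1, mulrN1, mulN1r, add0r, oppr0).
  rewrite -!mul_polyC; have -> : K%:P = (K / 2)%:P *+ 2 :> {poly R}.
    by rewrite -polyCMn; congr _%:P; field.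
  ring.
have K0 : 0 <= K by apply: le_trans (h2 a _); rewrite ?normr_ge0 // lexx lerDl ler01.
have : 0 <= g.[t].
  apply: (@concave_poly_ge0 _ _ a (a + 1)) => //.
  - move=> x /h2; rewrite g2 !hornerE ler_norml => /andP[h3 h4]; lra.
  - by rewrite gx; move: ha; rewrite ler_norml => /andP[h3 h4]; lra.
  - by rewrite gx; move: hb; rewrite ler_norml => /andP[h3 h4]; lra.
rewrite gx => h3.
have : (t - a) * (a + 1 - t) <= 1 / 4 by have := sqr_ge0 (t - a - 1 / 2); nra.
by move=> /(ler_wpM2l K0); lra.
Qed.

Lemma poly_interval_bound (R : realDomainType) (q : {poly R}) (L x : R) :
  0 <= x <= L -> `|q.[x]| <= \sum_(i < size q) `|q`_i| * L ^+ i.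
Proof.
move=> /andP[x0 xL]; rewrite horner_coef; apply: le_trans (ler_norm_sum _ _ _) _.
apply: ler_sum => i _; rewrite normrM ler_wpM2l ?normr_ge0 // normrX ger0_norm //.
by apply: lerXn2r; rewrite ?nnegrE // (le_trans x0).
Qed.

(* The bound M on |p - 1/2| controls p'' by Markov's inequality, and p'' controls the
   deviation of p from its linear interpolation between consecutive integers. *)
Lemma integer_bounded_poly (R : realType) (n : nat) (p : {poly R}) (M : R) :
  (0 < n)%N -> 0 < M -> (forall i : nat, (i <= n)%N -> 0 <= p.[i%:R] <= 1) ->
  let q := p - (1 / 2)%:P in
  (forall x, 0 <= x <= n%:R -> `|q.[x]| <= M) ->
  let D := (((size p).-1) ^ 2)%:R : R in
  forall x, 0 <= x <= n%:R ->
    `|q.[x]| <= 1 / 2 + D * (D - 1) / (6 * n%:R ^+ 2) * M.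
Proof.
move=> n0 M0 p01 q qM D x /andP[x0 xn].
set d := (size p).-1 in D *.
have nR : 0 < n%:R :> R by rewrite ltr0n.
have qint i : (i <= n)%N -> `|q.[i%:R]| <= 1 / 2.
  by move=> /p01/andP[h1 h2]; rewrite /q hornerD hornerN hornerC ler_norml; apply/andP; split; lra.
have sq : (size q <= d.+1)%N.
  apply: leq_trans (size_polyD _ _) _; rewrite size_polyN geq_max leqSpred /=.
  exact: leq_trans (size_polyC_leq1 _) _.
(* Markov's bound for q'': the 3 is 3!! in 3!! T_d''(1) = D (D - 1). *)
pose K := M * (2 / n%:R) ^+ 2 * (D * (D - 1) / 3).
have DK : 0 <= D * (D - 1).
  rewrite /D.
  have [->|d0] := posnP d; first by rewrite exp0n // mul0r.
  by rewrite mulr_ge0 ?ler0n // subr_ge0 ler1n expn_gt0 d0.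
have K0 : 0 <= K.
  by rewrite /K mulr_ge0 ?divr_ge0 // mulr_ge0 ?sqr_ge0 // ltW.
have q2 t : 0 <= t <= n%:R -> `|q^`(2).[t]| <= K.
  move=> tn; have [d2|d2] := leqP 2 d; last first.
    by rewrite derivn_poly0 ?horner0 ?normr0 // (leq_trans sq).
  have -> : K = M * (2 / n%:R) ^+ 2 * (chebT R d)^`(2).[1].
    congr (_ * _); have := chebT_derivn1 R d 2.
    rewrite big_ord_recr big_ord_recr big_ord0 /= mul1r subr0 -/D.
    by rewrite muln1 => <-; field.
  by apply: markov_brothers_interval; rewrite ?d2.
have -> : D * (D - 1) / (6 * n%:R ^+ 2) * M = K / 8.
  by rewrite /K; field; rewrite gt_eqF.
(* At x = n truncation would select [n, n + 1], which leaves the range; but n is itself one of the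
   integer points. *)
move: xn; rewrite le_eqVlt => /predU1P[->|xn].
  by apply: le_trans (qint n (leqnn n)) _; rewrite lerDl divr_ge0.
have /andP[j1 j2] := truncn_itv x0.
set j := Num.truncn x in j1 j2.
have jn : (j < n)%N by rewrite -(ltr_nat R); apply: le_lt_trans xn.
apply: (@unit_interval_bound _ _ j%:R) => //.
- move=> t /andP[t1 t2]; apply: q2; rewrite (le_trans _ t1) ?ler0n //=.
  by apply: le_trans t2 _; rewrite natr1 ler_nat.
- exact: qint (ltnW jn).
- by rewrite natr1; apply: qint.
- by rewrite j1 natr1 ltW.
Qed.

Unset Implicit Arguments.

Theorem theorem8 (R : realType) (n k : nat) (c : R) (p : {poly R}) :
  (1 <= n)%N -> (1 <= k)%N -> 0 < c ->
  (forall i : nat, (i <= n)%N -> 0 <= p.[i%:R] <= 1) ->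
  c <= sup [set `|(p^`(k)).[x]| | x in `[0, n%:R]%classic] ->
  let d := (size p).-1 in
  let x := (d ^ 2)%:R / n%:R : R in
  Num.sqrt (6 : R) * n%:R <= (d ^ 2)%:R \/
  (1 - x ^+ 2 / 6) * ((dfact (2 * k).-1)%:R / 2 ^+ k.-1) * c < x ^+ k.
Proof.
move=> n0 k0 c0 p01 csup d x.
have nR : 0 < n%:R :> R by rewrite ltr0n.
have [?|sm] := leP (Num.sqrt (6 : R) * n%:R) (d ^ 2)%:R; [by left | right].
have c_le B : (forall t, 0 <= t <= n%:R -> `|p^`(k).[t]| <= B) -> c <= B.
  move=> hB; apply: le_trans csup _; apply: ge_sup.
    by exists `|p^`(k).[0]|, 0; rewrite //= in_itv /= lexx ltW.
  by move=> _ [t + <-]; rewrite /= in_itv /=; apply: hB.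
(* For k > d the k-th derivative vanishes, which would force c <= 0. *)
have [kd|dk] := leqP k d; last first.
  suff : c <= 0 by rewrite leNgt c0.
  apply: c_le => t _; rewrite derivn_poly0 ?horner0 ?normr0 //.
  exact: leq_trans (leqSpred _) _.
set D := (d ^ 2)%:R in x sm *.
have D1 : 1 <= D by rewrite ler1n expn_gt0 (leq_trans k0 kd).
pose q := p - (1 / 2)%:P.
pose S := [set `|q.[t]| | t in `[0, n%:R]%classic].
have Sub : has_sup S.
  split; first by exists `|q.[0]|, 0; rewrite //= in_itv /= lexx ltW.
  exists (\sum_(i < size q) `|q`_i| * n%:R ^+ i) => _ [t + <-].
  by rewrite /= in_itv /=; apply: poly_interval_bound.
(* The maximum with 1/2 makes M positive, and 1/2 obviously satisfies the inequality [Mb]. *)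
pose M := Num.max (1 / 2) (sup S).
have M0 : 0 < M by rewrite lt_max divr_gt0.
have qM t : 0 <= t <= n%:R -> `|q.[t]| <= M.
  move=> tn; rewrite le_max; apply/orP; right; apply: ub_le_sup; first by case: Sub.
  by exists t => //; rewrite /= in_itv.
have qb := integer_bounded_poly n0 M0 p01 qM; rewrite /= -/d -/D -/q in qb.
set beta := D * (D - 1) / (6 * n%:R ^+ 2) in qb.
have beta0 : 0 <= beta by rewrite divr_ge0 ?mulr_ge0 ?sqr_ge0 ?subr_ge0 //; lra.
have Mb : M <= 1 / 2 + beta * M.
  rewrite ge_max lerDl mulr_ge0 ?(ltW M0) //=; apply: ge_sup; first by case: Sub.
  by move=> _ [t + <-]; rewrite /= in_itv /=; apply: qb.
(* Markov's inequality for q on [0, n], combined with (2k-1)!! T_d^(k)(1) <= D^k and D / n = x. *)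
have kc : (dfact (2 * k).-1)%:R * c <= M * 2 ^+ k * x ^+ k.
  have df : 0 <= (dfact (2 * k).-1)%:R :> R by rewrite ler0n.
  have : c <= M * (2 / n%:R) ^+ k * (chebT R d)^`(k).[1].
    apply: c_le => t tn.
    have -> : p^`(k) = q^`(k).
      by rewrite /q derivnB derivnC gtn_eqF // subr0.
    apply: markov_brothers_interval; rewrite ?k0 //.
    apply: leq_trans (size_polyD _ _) _; rewrite size_polyN geq_max leqSpred /=.
    exact: leq_trans (size_polyC_leq1 _) _.
  move=> /(ler_wpM2l df) /le_trans; apply.
  rewrite mulrCA; apply: le_trans (_ : M * (2 / n%:R) ^+ k * D ^+ k <= _).
    by rewrite ler_wpM2l ?chebT_derivn1_le // mulr_ge0 ?exprn_ge0 ?divr_ge0 // ltW.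
  by rewrite /x !exprMn; rewrite le_eqVlt; apply/predU1P; left; ring.
have x0 : 0 < x by rewrite divr_gt0 // (lt_le_trans ltr01).
have A0 : 0 < 1 - x ^+ 2 / 6.
  rewrite subr_gt0 ltr_pdivrMr // mul1r expr_div_n ltr_pdivrMr ?exprn_gt0 //.
  rewrite -[6](@sqr_sqrtr _ 6) // -exprMn ltr_pXn2r ?nnegrE //.
  by rewrite mulr_ge0 ?sqrtr_ge0 // ltW.
(* The strict inequality of the conclusion originates here, from D (D - 1) < D^2. *)
have Ab : 1 - x ^+ 2 / 6 < 1 - beta.
  rewrite ltrD2l ltrN2.
  have -> : x ^+ 2 / 6 = D * D / (6 * n%:R ^+ 2) by rewrite /x; field; rewrite gt_eqF.
  rewrite ltr_pM2r ?invr_gt0 ?mulr_gt0 ?exprn_gt0 //.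
  by rewrite ltr_pM2l; lra.
have xk : 0 < x ^+ k by apply: exprn_gt0.
have e2 : 2 ^+ k = 2 * 2 ^+ k.-1 :> R by rewrite -exprS prednK.
have p2 : 0 < 2 ^+ k.-1 :> R by rewrite exprn_gt0.
apply: le_lt_trans (_ : (1 - x ^+ 2 / 6) * (2 * M * x ^+ k) < _).
  rewrite -mulrA ler_pM2l // mulrAC ler_pdivrMr //.
  by apply: le_trans kc _; rewrite e2; rewrite le_eqVlt; apply/predU1P; left; ring.
rewrite mulrA gtr_pMl //.
(* [Mb] says (1 - beta) M <= 1/2, hence 2 (1 - x^2 / 6) M < 1. *)
by have : (1 - x ^+ 2 / 6) * M < (1 - beta) * M by [rewrite ltr_pM2r]; lra.
Qed.
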